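(* For each $p \in (1,2]$ there is $C > 0$ such that for any function $f \in \ell^p(\mathbb{Z})$, \[ \Big\| \sup_{N \in \mathbb{N}} \big|\mathcal{M}_N f\big| \Big\|_{\ell^p} \leq C (p-1)^{-4} \|f\|_{\ell^p}. \]
   Context: $\mathbb{N}$ is the set of positive integers and $\mathbb{P}_N$ is the set of prime numbers not larger than $N$. For $f : \mathbb{Z} \to \mathbb{C}$, \[ \mathcal{M}_N f(x) = \frac{1}{\vartheta(N)} \sum_{p \in \mathbb{P}_N} f(x+p) \log p, \qquad \vartheta(N) = \sum_{p \in \mathbb{P}_N} \log p \] (here the summation variable $p$ runs over primes), with the convention $\mathcal{M}_1 f = 0$ (as $\vartheta(1)=0$). *)

(* Defs.v *)
From HB Require Import structures.
From mathcomp Require Import all_boot all_order all_algebra.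
From mathcomp Require Import all_classical all_reals all_analysis.
From mathcomp Require Import complex.

Set Implicit Arguments.
Unset Strict Implicit.
Unset Printing Implicit Defensive.

Import Order.TTheory GRing.Theory Num.Theory.

Local Open Scope classical_set_scope.
Local Open Scope ring_scope.
Local Open Scope complex_scope.

(* The discrete sigma-algebra on int (as the library does for nat), so that
   l^p(Z) is the L^p space of the counting measure. *)
HB.instance Definition _ := isPointed.Build int 0.
HB.instance Definition _ := @isMeasurable.Build default_measure_display
  int discrete_measurable discrete_measurable0
  discrete_measurableC discrete_measurableU.

Section PrimeAverages.
Context {R : realType}.

Definition theta (N : nat) : R := \sum_(0 <= q < N.+1 | prime q) ln q%:R.

(* For N <= 1 the sum is empty, so this is 0, as the usual convention wants. *)
Definition prime_average (N : nat) (f : int -> R[i]) (x : int) : R[i] :=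
  (theta N)^-1%:C *
  \sum_(0 <= q < N.+1 | prime q) f (x + q%:Z) * (ln q%:R)%:C.

(* Extended-real valued: the supremum is not assumed to be finite. *)
Definition prime_maximal (f : int -> R[i]) (x : int) : \bar R :=
  ereal_sup [set (Normc.normc (prime_average N f x))%:E | N in [set N | (0 < N)%N]].

Definition ellp_norm (p : R) (g : int -> \bar R) : \bar R :=
  Lnorm (@counting int R) p%:E g.

Definition ellp_normC (p : R) (f : int -> R[i]) : \bar R :=
  ellp_norm p (fun x => (Normc.normc (f x))%:E).

(* Every function on the discrete space int is measurable. *)
Definition in_ellp (p : R) (f : int -> R[i]) : Prop := (ellp_normC p f < +oo)%E.

End PrimeAverages.

(* Main.v *)
Require Import Defs.
From mathcomp Require Import all_boot all_order all_algebra.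
From mathcomp Require Import all_classical all_reals all_analysis.
From mathcomp Require Import complex.
From mathcomp Require Import zify ring lra.

Set Implicit Arguments.
Unset Strict Implicit.
Unset Printing Implicit Defensive.

Import Order.TTheory GRing.Theory Num.Theory.

Local Open Scope ring_scope.

(** The maximal function only needs an upper bound, so the primes may be
    replaced by a sieve majorant, and everything becomes elementary.

    For a prime [r] let [e_r(n)] be [-1] if [r] divides [n] and [1/(r-1)]
    otherwise, and let [e_T] be the product of the [e_r] over a finite set [T]
    of primes; up to sign and scaling, [e_T] is the Ramanujan sum whose modulus
    is the product of [T].  With [Q = 2^j], Selberg's sum
    [Lambda = sum of e_S over the S with product at most Q] takes at every
    prime larger than [Q] the value [G = sum of 1/phi(S)], and
    [G >= (j+1)/4].  Hence [nu = Lambda^2/G] is nonnegative, and it is at least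
    [(j+1)/4] at these primes ([selberg_weight]).
    Multiplying out by means of [e_r^2 = 1/(r-1) - (r-2)/(r-1) e_r] gives
    [nu = sum of w(T) e_T] with [|w(T)| <= 4^|T|] and [w(T) = 0] as soon as the
    product of [T] exceeds [Q^2] ([sieve_square]).

    It remains to bound the maximal function of the averages against [nu],
    where [j] is the integral part of [k/32] for averages of length [2^k], so
    that [j+1] is comparable with the logarithm of the length.  Sort the sets
    [T] by the size [2^s] of their product.  For each [s] let [T_s] be
    the supremum over [k] of the averages against the part of [nu] of size
    [2^s]; as the supremum is attained on a bounded range of [k], it can be
    replaced by a choice of [k] at each point, which makes [T_s] linear.

    - On [l^p] with any [p > 1], the norm of [T_s] is at most a constant times
      [2^(eps s)]: a Ramanujan sum is dominated by a divisor sum, and each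
      divisor contributes a Hardy-Littlewood maximal function along an
      arithmetic progression ([piece_lp]).
    - On [l^2], the norm of [T_s] is at most a constant times
      [2^(-(1-eps)s/2)].  In the kernel of [T_s] composed with its adjoint the
      Ramanujan sums of distinct moduli are orthogonal, because all averages
      are much longer than the moduli.  The surviving diagonal terms are
      bounded in absolute value by the sum of [16^|T| |e_T| / phi(T)] over
      intervals of the larger of the two lengths, so they are controlled by
      maximal functions once more, with total mass about [2^(-s)] ([piece_l2]).
      All [k] are treated at once.

    Interpolating between the two bounds gives a factor [2^(-cs)] on [l^p] for
    [1 < p <= 2] ([piece_decay]), which is summable over [s] ([sum_pieces]).
    The primes up to [Q] are absorbed by the Hardy-Littlewood maximal function
    ([prime_window]), and the bound [theta(N) >= cN] ([chebyshev_pow2]) turns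
    the normalisation by [theta] into the one by [N].  All estimates are
    uniform over finite windows, and monotone convergence passes to the whole
    of the integers.  The factor [(p-1)^(-4)] is a constant for fixed [p]. *)

(** * Marcinkiewicz interpolation on windows of integers *)

Lemma powRD_gt0 (R : realType) (x r s : R) : 0 < x ->
  x `^ (r + s) = x `^ r * x `^ s.
Proof. by move=> x0; rewrite powRD // (gt_eqF x0) implybT. Qed.

(** The sum over powers of 2 below [a] is dominated by its largest term. The
starting point [t] is arbitrary, so that one constant serves every range of
levels. *)
Lemma geom_up (R : realType) (al : R) : 0 < al ->
  exists2 C : R, 0 < C & forall (n : nat) (t a : R), 0 < t -> 0 < a ->
   \sum_(j < n | t * 2 ^+ j < a) (t * 2 ^+ j) `^ al <= C * a `^ al.
Proof.
move=> al0; set r := (2 : R) `^ al.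
have r1 : 1 < r.
  have := @gt0_ltr_powR R al al0 1 2; rewrite powR1; apply; rewrite ?nnegrE //; lra.
have r0 : 0 < r - 1 by lra.
exists (r / (r - 1)) => [|n t a t0 a0]; first by rewrite divr_gt0 //; lra.
have tj j : (t * 2 ^+ j) `^ al = t `^ al * r ^+ j.
  rewrite powRM ?ltW // ?exprn_gt0 //; congr (_ * _).
  by rewrite -powR_mulrn // -powRrM mulrC powRrM powR_mulrn // powR_ge0.
elim: n => [|n IH]; first by rewrite big_ord0 mulr_ge0 ?powR_ge0 // divr_ge0; lra.
rewrite big_mkcond big_ord_recr /= -big_mkcond /=; case: ifP => h; last by rewrite addr0.
apply: (@le_trans _ _ (r / (r - 1) * (t * 2 ^+ n) `^ al)); last first.
  rewrite ler_wpM2l // ?divr_ge0 //; try lra.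
  by rewrite ge0_ler_powR ?nnegrE ?mulr_ge0 ?exprn_ge0 ?ltW.
apply: (@le_trans _ _ (\sum_(j < n.+1) t `^ al * r ^+ j)).
  rewrite big_ord_recr /= tj lerD2r big_mkcond /=; apply: ler_sum => j _.
  by case: ifP => _; rewrite ?tj // mulr_ge0 ?powR_ge0 // exprn_ge0 //; lra.
rewrite -mulr_sumr tj [leRHS]mulrCA ler_wpM2l ?powR_ge0 //.
rewrite -(ler_pM2l r0) -subrX1 mulrA mulrCA divff ?mulr1; last by rewrite gt_eqF.
by rewrite exprS; lra.
Qed.

Lemma geom_down (R : realType) (be : R) : 0 < be ->
  exists2 C : R, 0 < C & forall (n : nat) (t a : R), 0 < t -> 0 < a ->
   \sum_(j < n | a <= t * 2 ^+ j) (t * 2 ^+ j) `^ (- be) <= C * a `^ (- be).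
Proof.
move=> be0; set r := (2 : R) `^ (- be).
have r1 : r < 1.
  rewrite /r powRN invf_lt1 ?powR_gt0 //.
  have := @gt0_ltr_powR R be be0 1 2; rewrite powR1; apply; rewrite ?nnegrE //; lra.
have r0 : 0 < r by rewrite powR_gt0.
exists ((1 - r)^-1) => [|n t a t0 a0]; first by rewrite invr_gt0; lra.
elim: n t t0 => [|n IH] t t0; first by rewrite big_ord0 mulr_ge0 ?powR_ge0 // invr_ge0; lra.
have tj j : (t * 2 ^+ j) `^ (- be) = t `^ (- be) * r ^+ j.
  rewrite powRM ?ltW // ?exprn_gt0 //; congr (_ * _).
  by rewrite -powR_mulrn // -powRrM mulrC powRrM powR_mulrn // powR_ge0.
have [h|h] := leP a t; last first.
  (* The first level is too low: drop it and start at 2t. *)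
  rewrite big_mkcond big_ord_recl /= expr0 mulr1 (lt_geF h) add0r.
  rewrite -big_mkcond /=; apply: le_trans (IH (t * 2) _); last by rewrite mulr_gt0.
  rewrite le_eqVlt; apply/orP; left; apply/eqP; apply: eq_big => j.
    by rewrite /bump /= add1n exprS mulrA.
  by rewrite /bump /= add1n exprS mulrA.
apply: (@le_trans _ _ (\sum_(j < n.+1) t `^ (-be) * r ^+ j)).
  rewrite big_mkcond /=; apply: ler_sum => j _.
  by case: ifP => _; rewrite ?tj // mulr_ge0 ?powR_ge0 // exprn_ge0 //; lra.
rewrite -mulr_sumr mulrC; apply: ler_pM; rewrite ?powR_ge0 ?sumr_ge0 //.
- by move=> i _; rewrite exprn_ge0 // ltW.
- rewrite -(ler_pM2l (_ : 0 < 1 - r)); last by lra.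
  rewrite divff; last by rewrite gt_eqF //; lra.
  have -> : 1 - r = - (r - 1) by ring.
  rewrite mulNr -subrX1 opprB gerBl exprn_ge0 //; lra.
- rewrite !powRN lef_pV2 ?posrE ?powR_gt0 //.
  by rewrite ge0_ler_powR ?nnegrE // ltW.
Qed.

(** The factor 2 in both bounds is there because the weak-type hypothesis of
[marcinkiewicz] splits the level [2 * t] between the two parts of [f]. *)
Lemma dyadic_shell (R : realType) (t F : R) (n : nat) :
  0 < t -> 2 * t < F -> F <= 2 * (t * 2 ^+ n) ->
  exists2 j : 'I_n, 2 * (t * 2 ^+ j) < F & F <= 4 * (t * 2 ^+ j).
Proof.
move=> t0; elim: n => [|n IH] h1 h2.
  by move: h2; rewrite expr0 mulr1 leNgt h1.
have [h|h] := leP F (2 * (t * 2 ^+ n)).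
  by have [j ? ?] := IH h1 h; exists (widen_ord (leqnSn n) j).
exists ord_max => //=; move: h2; rewrite exprS; lra.
Qed.

(** Layer cake over dyadic levels. The hypothesis is what a sublinear operator
satisfies when [f] is cut at height [ga * t], the large part being measured by
an inequality of exponent [p0] and the small part by one of exponent [p1].
Summing the geometric series in [t] at each point of the window leaves the
powers of [ga]; the free parameter [ga] is what makes a decay in [B] outweigh
a growth in [A]. *)
Lemma marcinkiewicz (R : realType) (p0 p p1 : R) : 0 < p0 -> p0 < p -> p < p1 ->
  exists2 C : R, 0 < C & forall (L : nat) (F f : nat -> R) (A B ga : R),
   0 <= A -> 0 <= B -> 0 < ga ->
   (forall x, 0 <= F x) -> (forall x, 0 <= f x) ->
   (forall t, 0 < t -> \sum_(x < L | 2 * t < F x) 1 <=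
      A * t `^ (- p0) * \sum_(z < L | ga * t < f z) f z `^ p0 +
      B * t `^ (- p1) * \sum_(z < L | f z <= ga * t) f z `^ p1) ->
   \sum_(x < L) F x `^ p <=
     C * (A * ga `^ (p0 - p) + B * ga `^ (p1 - p)) * \sum_(z < L) f z `^ p.
Proof.
move=> p00 p0p pp1; have p_gt0 : 0 < p by lra.
have [C1 C10 up] := @geom_up R (p - p0) ltac:(lra).
have [C2 C20 down] := @geom_down R (p1 - p) ltac:(lra).
exists (4 `^ p * (C1 + C2)); first by rewrite mulr_gt0 ?powR_gt0 //; lra.
move=> L F f A B ga A0 B0 ga0 F0 f0 H.
have [t t0 [n Hn]] : exists2 t : R, 0 < t & exists n, forall x : 'I_L, 0 < F x ->
    2 * t < F x /\ F x <= 2 * (t * 2 ^+ n).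
  (* One constant bounds all values and all inverses of positive values. *)
  pose S := \sum_(x < L) (F x + (F x)^-1) + 1.
  have Sx (x : 'I_L) : F x < S /\ (F x)^-1 < S.
    have : F x + (F x)^-1 <= \sum_(x < L) (F x + (F x)^-1).
      rewrite (bigD1 x) //= lerDl; apply: sumr_ge0 => i _.
      by rewrite addr_ge0 ?invr_ge0.
    have := F0 x; have : 0 <= (F x)^-1 by rewrite invr_ge0.
    by rewrite /S; move: (\sum_(_ < _) _) (F x) ((F x)^-1) => U V W; lra.
  have S1 : 1 <= S.
    by rewrite /S lerDr; apply: sumr_ge0 => i _; rewrite addr_ge0 ?invr_ge0.
  exists ((4 * S)^-1); first by rewrite invr_gt0; lra.
  have [N HN] : exists N : nat, 2 * S * S <= N%:R.
    exists (Num.truncn (2 * S * S)).+1; apply/ltW/truncnS_gt; nra.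
  exists N => x Fx; have [h1 h2] := Sx x; split.
    rewrite invfM -[X in _ < X]invrK mulrA.
    have -> : 2 * 4^-1 = 2^-1 :> R by field.
    rewrite -invfM ltf_pV2 ?posrE ?invr_gt0 ?mulr_gt0 //; lra.
  rewrite (le_trans (ltW h1)) // mulrCA.
  rewrite ler_pdivlMl; last by lra.
  have : N%:R <= (2 ^+ N : R) by rewrite -natrX ler_nat ltnW // ltn_expl.
  by move=> h3; nra.
pose tj (j : nat) := t * 2 ^+ j.
have tj0 j : 0 < tj j by rewrite mulr_gt0 ?exprn_gt0.
have step1 : \sum_(x < L) F x `^ p <=
    \sum_(j < n) (4 * tj j) `^ p * \sum_(x < L | 2 * tj j < F x) 1.
  under [leRHS]eq_bigr do rewrite mulr_sumr big_mkcond.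
  rewrite exchange_big /=; apply: ler_sum => x _.
  have := F0 x; rewrite le_eqVlt => /predU1P[<-|Fx].
    rewrite powR0 ?gt_eqF //; apply: sumr_ge0 => j _.
    by case: ifP => // _; rewrite mulr1 powR_ge0.
  have [h1 h2] := Hn x Fx; have [j h3 h4] := dyadic_shell t0 h1 h2.
  rewrite (bigD1 j) //= /tj h3 mulr1 -[leLHS]addr0; apply: lerD.
    by rewrite ge0_ler_powR ?nnegrE ?(ltW p_gt0) ?(ltW Fx) ?mulr_ge0 ?exprn_ge0 ?(ltW t0).
  by apply: sumr_ge0 => i _; case: ifP => // _; rewrite mulr1 powR_ge0.
apply: (le_trans step1).
apply: (@le_trans _ _ (\sum_(j < n) 4 `^ p *
   (A * (tj j `^ (p - p0) * \sum_(z < L | ga * tj j < f z) f z `^ p0) +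
    B * (tj j `^ (- (p1 - p)) * \sum_(z < L | f z <= ga * tj j) f z `^ p1)))).
  apply: ler_sum => j _.
  rewrite powRM ?(ltW (tj0 _)) // -mulrA ler_wpM2l ?powR_ge0 //.
  apply: le_trans (ler_wpM2l (powR_ge0 _ _) (H _ (tj0 j))) _.
  have e q : tj j `^ (p - q) = tj j `^ p * tj j `^ (- q).
    by rewrite powRD_gt0.
  rewrite opprB !e le_eqVlt; apply/orP; left; apply/eqP; ring.
rewrite -mulr_sumr -!mulrA ler_wpM2l ?powR_ge0 // big_split /= -!mulr_sumr.
have E1 : \sum_(j < n) tj j `^ (p - p0) * \sum_(z < L | ga * tj j < f z) f z `^ p0
   <= C1 * ga `^ (p0 - p) * \sum_(z < L) f z `^ p.
  under eq_bigr do rewrite mulr_sumr big_mkcond.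
  rewrite exchange_big mulr_sumr /=; apply: ler_sum => z _.
  rewrite -big_mkcond -mulr_suml.
  have := f0 z; rewrite le_eqVlt => /predU1P[<-|fz].
    by rewrite [in leLHS]powR0 ?gt_eqF // mulr0 mulr_ge0 ?powR_ge0 // mulr_ge0 ?powR_ge0 // ltW.
  have fg : 0 < f z / ga by rewrite divr_gt0.
  have := up n t _ t0 fg => {}up.
  have {}up : \sum_(j < n | ga * tj j < f z) tj j `^ (p - p0) <= C1 * (f z / ga) `^ (p - p0).
    apply: le_trans up; rewrite le_eqVlt; apply/orP; left; apply/eqP; apply: eq_bigl => j.
    by rewrite ltr_pdivlMr // mulrC.
  apply: le_trans (ler_wpM2r (powR_ge0 _ _) up) _.
  rewrite powRM ?invr_ge0 ?(ltW fz) ?(ltW ga0) // -powR_inv1 ?(ltW ga0) // -powRrM.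
  rewrite mulN1r opprB -!mulrA ler_wpM2l ?(ltW C10) // [leLHS]mulrCA ler_wpM2l ?powR_ge0 //.
  by rewrite -powRD_gt0 ?subrK.
have E2 : \sum_(j < n) tj j `^ (- (p1 - p)) * \sum_(z < L | f z <= ga * tj j) f z `^ p1
   <= C2 * ga `^ (p1 - p) * \sum_(z < L) f z `^ p.
  under eq_bigr do rewrite mulr_sumr big_mkcond.
  rewrite exchange_big mulr_sumr /=; apply: ler_sum => z _.
  rewrite -big_mkcond -mulr_suml.
  have := f0 z; rewrite le_eqVlt => /predU1P[<-|fz].
    rewrite [in leLHS]powR0 ?gt_eqF //; last by lra.
    by rewrite mulr0 mulr_ge0 ?powR_ge0 // mulr_ge0 ?powR_ge0 // ltW.
  have fg : 0 < f z / ga by rewrite divr_gt0.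
  have := down n t _ t0 fg => {}up.
  have {}up : \sum_(j < n | f z <= ga * tj j) tj j `^ (- (p1 - p)) <= C2 * (f z / ga) `^ (- (p1 - p)).
    apply: le_trans up; rewrite le_eqVlt; apply/orP; left; apply/eqP; apply: eq_bigl => j.
    by rewrite ler_pdivrMr // mulrC.
  apply: le_trans (ler_wpM2r (powR_ge0 _ _) up) _.
  rewrite powRM ?invr_ge0 ?(ltW fz) ?(ltW ga0) // -[in leLHS](powR_inv1 (ltW ga0)) -powRrM.
  rewrite mulN1r opprK -!mulrA ler_wpM2l ?(ltW C20) // [leLHS]mulrCA ler_wpM2l ?powR_ge0 //.
  by rewrite -powRD_gt0 ?opprB ?subrK.
have S0 : 0 <= \sum_(z < L) f z `^ p by apply: sumr_ge0 => i _; apply: powR_ge0.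
have := ler_wpM2l A0 E1; have := ler_wpM2l B0 E2.
have : 0 <= A * (C2 * ga `^ (p0 - p) * \sum_(z < L) f z `^ p).
  by rewrite !mulr_ge0 ?powR_ge0 // ltW.
have : 0 <= B * (C1 * ga `^ (p1 - p) * \sum_(z < L) f z `^ p).
  by rewrite !mulr_ge0 ?powR_ge0 // ltW.
move: (\sum_(z < L) _) (ga `^ _) (ga `^ _) => S u v a1 a2 a3 a4.
move: (\sum_(_ < _) _) (\sum_(_ < _) _) a3 a4 => U V a3 a4.
have -> : (C1 + C2) * ((A * u + B * v) * S) =
  A * (C1 * u * S) + B * (C2 * v * S) + (A * (C2 * u * S)) + B * (C1 * v * S) by ring.
move: a1 a2 a3 a4; lra.
Qed.

(** * Hardy-Littlewood maximal functions along arithmetic progressions *)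

Lemma sum_shift (R : nmodType) (a n : nat) (F : nat -> R) :
  \sum_(a <= z < a + n) F z = \sum_(j < n) F (a + j)%N.
Proof.
rewrite -{1}(add0n a) big_addn addKn big_mkord.
by apply: eq_bigr => i _; rewrite addnC.
Qed.

(** Scan the window from the left. At a point where the average exceeds [t], pay
for the next [J] points with the sum of [f] over them, and jump past them;
at any other point move on by one. *)
Lemma hl_weak (R : realType) (L : nat) (f : nat -> R) (J : nat -> nat) (t : R) (a : nat) :
  (forall z, 0 <= f z) -> (forall z, (L <= z)%N -> f z = 0) ->
  (forall x, (0 < J x)%N) -> 0 < t ->
  t * (\sum_(a <= x < L | t * (J x)%:R < \sum_(j < J x) f (x + j)%N) 1)
    <= \sum_(a <= z < L) f z.
Proof.
move=> f0 fL J0 t0; have [n] := ubnP (L - a)%N.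
elim: n a => // n IH a; rewrite ltnS => hn.
have [La|aL] := leqP L a; first by rewrite !big_geq // mulr0.
have [aE|aE] := ltP (t * (J a)%:R) (\sum_(j < J a) f (a + j)%N); last first.
  rewrite big_ltn_cond // (le_gtF aE) [leRHS]big_ltn //.
  by apply: le_trans (IH _ _) _; [lia | rewrite lerDr].
pose b := minn (a + J a) L.
have ab : (a <= b)%N by rewrite /b; lia.
have bL : (b <= L)%N by rewrite /b; lia.
rewrite (big_cat_nat ab bL) /= [leRHS](big_cat_nat ab bL) /= mulrDr.
have h : (L - b < n)%N by have := J0 a; rewrite /b; lia.
apply: lerD; last exact: IH.
apply: (@le_trans _ _ (t * (J a)%:R)).
  rewrite ler_pM2l //; apply: (@le_trans _ _ (\sum_(a <= x < b) 1)).
    by rewrite big_mkcond; apply: ler_sum => x _; case: ifP.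
  by rewrite sumr_const_nat ler_nat /b; lia.
apply: (le_trans (ltW aE)).
rewrite -sum_shift.
have ba : (b <= a + J a)%N by rewrite /b; lia.
rewrite (big_cat_nat ab ba) /= gerDl big_nat big1 // => z hz.
by apply: fL; move: hz; rewrite /b; lia.
Qed.

(** Only the values of [f] above [t] contribute to an average above [2 * t], so the
weak inequality of exponent 1 suffices, with nothing to pay for the small part. *)
Lemma hl_strong (R : realType) (p : R) : 1 < p ->
  exists2 C : R, 0 < C & forall (L : nat) (f : nat -> R) (J : nat -> nat),
    (forall z, 0 <= f z) -> (forall z, (L <= z)%N -> f z = 0) ->
    (forall x, (0 < J x)%N) ->
    \sum_(x < L) ((J x)%:R^-1 * \sum_(j < J x) f (x + j)%N) `^ p <=
      C * \sum_(z < L) f z `^ p.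
Proof.
move=> p1; have pp : p < p + 1 by lra.
have [C C0 H] := marcinkiewicz ltr01 p1 pp.
exists C => // L f J f0 fL J0.
have := H L (fun x => (J x)%:R^-1 * \sum_(j < J x) f (x + j)%N) f 1 0 1.
rewrite powR1 mul0r mulr1 addr0 mulr1; apply=> // [x|t t0].
  by rewrite mulr_ge0 ?invr_ge0 ?sumr_ge0.
rewrite !mul0r addr0 mul1r mul1r.
pose g z := if t < f z then f z else 0.
have g0 z : 0 <= g z by rewrite /g; case: ifP.
have gL z : (L <= z)%N -> g z = 0 by move=> zL; rewrite /g fL // (le_gtF (ltW t0)).
have := hl_weak 0 g0 gL J0 t0.
rewrite -ler_pdivlMl // big_mkord => hw.
rewrite powR_inv1 ?(ltW t0) //.
apply: le_trans _ (le_trans hw _); last first.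
  rewrite ler_pM2l ?invr_gt0 // big_mkord [leRHS]big_mkcond /=.
  by apply: ler_sum => z _; rewrite /g; case: ifP => //; rewrite powRr1.
rewrite [leLHS]big_mkcond [leRHS]big_mkcond /=; apply: ler_sum => x _.
case: ifP => h; last by case: ifP.
rewrite ifT //.
move: h; have Jx : (0 : R) < (J x)%:R by rewrite ltr0n.
rewrite ltr_pdivlMl // => h.
have : \sum_(j < J x) f (x + j)%N <= \sum_(j < J x) g (x + j)%N + t * (J x)%:R.
  have -> : t * (J x)%:R = \sum_(j < J x) t by rewrite sumr_const card_ord mulr_natr.
  rewrite -big_split /=; apply: ler_sum => j _; rewrite /g.
  by case: (ltP t); lra.
by lra.
Qed.

Lemma sum_residues (R : nmodType) (d M : nat) (F : nat -> R) :
  \sum_(x < d * M) F x = \sum_(r < d) \sum_(i < M) F (r + d * i)%N.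
Proof.
rewrite exchange_big /=; elim: M => [|M IH]; first by rewrite muln0 !big_ord0.
rewrite big_ord_recr /= -IH.
rewrite -(big_mkord predT F) mulnS addnC (big_cat_nat (leq0n (d * M)) (leq_addr _ _)) /= big_mkord.
by congr (_ + _); rewrite sum_shift; apply: eq_bigr => i _; rewrite addnC.
Qed.

(** An arithmetic progression stays in one residue class, on which it is an
interval. The constant is therefore the same for all [d]. *)
Lemma hl_forward (R : realType) (p : R) : 1 < p ->
  exists2 C : R, 0 < C & forall (L d : nat) (f : nat -> R) (J : nat -> nat),
    (0 < d)%N ->
    (forall z, 0 <= f z) -> (forall z, (L <= z)%N -> f z = 0) ->
    (forall x, (0 < J x)%N) ->
    \sum_(x < L) ((J x)%:R^-1 * \sum_(j < J x) f (x + d * j)%N) `^ p <=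
      C * \sum_(z < L) f z `^ p.
Proof.
move=> p1; have [C C0 H] := hl_strong p1.
exists C => // L d f J d0 f0 fL J0.
have LdL : (L <= d * L)%N by rewrite leq_pmull.
have ext (F : nat -> R) : (forall x, 0 <= F x) -> \sum_(x < L) F x <= \sum_(x < d * L) F x.
  move=> F0; rewrite -!(big_mkord predT F) (big_cat_nat (leq0n L) LdL) /= lerDl.
  by apply: sumr_ge0.
apply: (@le_trans _ _ (\sum_(x < d * L) ((J x)%:R^-1 * \sum_(j < J x) f (x + d * j)%N) `^ p)).
  by apply: (ext (fun x => ((J x)%:R^-1 * \sum_(j < J x) f (x + d * j)%N) `^ p)) => x; rewrite powR_ge0.
have -> : \sum_(z < L) f z `^ p = \sum_(z < d * L) f z `^ p.
  rewrite -!(big_mkord predT (fun z => f z `^ p)) [RHS](big_cat_nat (leq0n L) LdL) /=.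
  rewrite [X in _ = _ + X]big_nat [X in _ = _ + X]big1 ?addr0 // => z /andP[hz _].
  by rewrite fL // powR0 // gt_eqF // (lt_trans ltr01).
rewrite (sum_residues d L (fun x => ((J x)%:R^-1 * \sum_(j < J x) f (x + d * j)%N) `^ p)).
rewrite (sum_residues d L (fun z => f z `^ p)) mulr_sumr; apply: ler_sum => r _.
have := H L (fun i => f (r + d * i)%N) (fun i => J (r + d * i)%N).
have := fun z (h : (L <= z)%N) => fL (r + d * z)%N.
move=> h1 /(_ (fun=> f0 _)) h2; apply: le_trans (h2 _ _) => //.
  by apply: ler_sum => i _; under eq_bigr do rewrite -addnA -mulnDr.
by move=> z Lz; apply: fL; nia.
Qed.

(** Reflection of the window. *)
Lemma hl_backward (R : realType) (p : R) : 1 < p ->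
  exists2 C : R, 0 < C & forall (L d : nat) (f : nat -> R) (J : nat -> nat),
    (0 < d)%N -> (forall z, 0 <= f z) -> (forall x, (0 < J x)%N) ->
    \sum_(x < L) ((J x)%:R^-1 * \sum_(j < J x | (d * j <= x)%N) f (x - d * j)%N) `^ p <=
      C * \sum_(z < L) f z `^ p.
Proof.
move=> p1; have [C C0 H] := hl_forward p1.
exists C => // L d f J d0 f0 J0.
have := H L d (fun z => if (z < L)%N then f (L.-1 - z)%N else 0) (fun x => J (L.-1 - x)%N) d0.
move=> /(_ (fun=> _)) h; apply: le_trans (le_trans (h _ _ _) _) => //.
- rewrite [leLHS](reindex_inj rev_ord_inj) /=; apply: ler_sum => x _.
  have -> : (L - x.+1 = L.-1 - x)%N by lia.
  rewrite ge0_ler_powR ?nnegrE ?mulr_ge0 ?invr_ge0 ?sumr_ge0 //; try lra.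
    by move=> i _; case: ifP.
  rewrite ler_pM2l ?invr_gt0 ?ltr0n // big_mkcond /=; apply: ler_sum => j _.
  have xL := ltn_ord x; case: ifP => h1; last by case: ifP.
  by rewrite ifT; [rewrite subnDA | lia].
- by move=> z; case: ifP.
- by move=> z Lz; rewrite ltnNge Lz.
rewrite ler_pM2l // [leRHS](reindex_inj rev_ord_inj) /=; apply: ler_sum => x _.
by rewrite ltn_ord; have -> : (L - x.+1 = L.-1 - x)%N by lia.
Qed.

(** * Normalised Ramanujan sums and the square of a sieve sum *)

(** This is [-c_p(n) / (p-1)] for the Ramanujan sum [c_p(n)], normalised so that
its value at an integer prime to [p] is the reciprocal of [phi(p)]. *)
Definition ram (R : realType) (p n : nat) : R :=
  if (p %| n)%N then -1 else (p.-1)%:R^-1.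

Definition ramS (R : realType) (m : nat) (T : {set 'I_m}) (n : nat) : R :=
  \prod_(p in T) ram R p n.

Definition setprod (m : nat) (T : {set 'I_m}) : nat := (\prod_(p in T) p)%N.

Definition primeset (m : nat) (T : {set 'I_m}) : bool := [forall p in T, prime p].

Definition phiS (R : realType) (m : nat) (T : {set 'I_m}) : R :=
  \prod_(p in T) (p.-1)%:R.

(** Multiplication table of the factors: for membership bits [b1], [b2] of [p] in
two sets, the product of the factors is [table true * ram + table false], the
last bit telling whether [p] belongs to the set of the resulting product. *)
Definition table (R : realType) (p : nat) (b1 b2 b : bool) : R :=
  if b then (if b1 && b2 then - ((p.-2)%:R / (p.-1)%:R) else (b1 || b2)%:R)
  else (if b1 && b2 then (p.-1)%:R^-1 else (~~ (b1 || b2))%:R).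

Definition table_coef (R : realType) (m : nat) (S1 S2 T : {set 'I_m}) : R :=
  \prod_(p < m) table R p (p \in S1) (p \in S2) (p \in T).

Lemma primesetP (m : nat) (T : {set 'I_m}) (p : 'I_m) : primeset T -> p \in T -> prime p.
Proof. by move=> /forall_inP h /h. Qed.

(** The case of two factors is the quadratic relation of a function that takes only
the two values [-1] and [1/(p-1)]. *)
Lemma table_mul (R : realType) (p n : nat) (b1 b2 : bool) : b1 || b2 -> prime p ->
  (if b1 then ram R p n else 1) * (if b2 then ram R p n else 1) =
  table R p b1 b2 true * ram R p n + table R p b1 b2 false.
Proof.
move=> hb pp; have p1 := prime_gt1 pp; rewrite /table.
case: b1 b2 hb => [] [] //= _; rewrite ?mul1r ?mulr1 ?addr0 //.
have e1 : (p.-1)%:R = p%:R - 1 :> R by rewrite -subn1 natrB // ltnW.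
have e2 : (p.-2)%:R = p%:R - 2 :> R by rewrite -subn2 natrB.
have h1 : p%:R - 1 != 0 :> R by rewrite -e1 pnatr_eq0; lia.
rewrite /ram e1 e2; case: ifP => _; by field.
Qed.

Lemma ramS_mul (R : realType) (m : nat) (S1 S2 : {set 'I_m}) (n : nat) :
  primeset S1 -> primeset S2 ->
  ramS R S1 n * ramS R S2 n = \sum_(T : {set 'I_m}) table_coef R S1 S2 T * ramS R T n.
Proof.
move=> h1 h2; rewrite /ramS.
rewrite big_mkcond [X in _ * X]big_mkcond /= -big_split /=.
have -> : \prod_(p < m) ((if p \in S1 then ram R p n else 1) *
                         (if p \in S2 then ram R p n else 1)) =
   \prod_(p < m) (table R p (p \in S1) (p \in S2) true * ram R p n +
                  table R p (p \in S1) (p \in S2) false).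
  apply: eq_bigr => p _.
  have [hb|] := boolP ((p \in S1) || (p \in S2)).
    apply: table_mul => //; by case/orP: hb; apply: primesetP.
  by rewrite negb_or => /andP[/negbTE-> /negbTE->]; rewrite /table /= mul0r add0r mulr1.
rewrite bigA_distr /=; apply: eq_bigr => T _.
rewrite /table_coef [X in _ * X]big_mkcond -big_split /=; apply: eq_bigr => p _.
by case: ifP => _; rewrite ?mulr1.
Qed.

Lemma table_coef_support (R : realType) (m : nat) (S1 S2 T : {set 'I_m}) :
  table_coef R S1 S2 T != 0 -> (T \subset S1 :|: S2) && (S1 :\: T == S2 :\: T).
Proof.
move=> /prodf_neq0 h; apply/andP; split.
  apply/fintype.subsetP => p pT; have := h p isT; rewrite pT /table inE.
  by case: (p \in S1) (p \in S2) => [] [] //=; rewrite eqxx.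
apply/eqP/setP => p; rewrite !inE; have := h p isT; rewrite /table.
by case: (p \in T) (p \in S1) (p \in S2) => [] [] [] //=; rewrite eqxx.
Qed.

(** The factors of size [1/(p-1)] come from the primes common to both sets and
absent from [T]; all other entries of the table are at most 1. *)
Lemma table_coef_bound (R : realType) (m : nat) (S1 S2 T : {set 'I_m}) :
  primeset S1 -> `|table_coef R S1 S2 T| <= (phiS R (S1 :\: T))^-1.
Proof.
move=> h1; rewrite /table_coef normr_prod /phiS -prodfV [leRHS]big_mkcond /=.
apply: ler_prod => p _; rewrite normr_ge0 /= inE /table.
have [pS|pS] := boolP (p \in S1); last first.
  rewrite andbF /=; case: (p \in T) (p \in S2) => [] [] //=;
  by rewrite ?normr0 ?normr1 ?ler01.
have := prime_gt1 (primesetP h1 pS) => p1.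
case: (p \in T) (p \in S2) => [] [] /=; rewrite ?normr1 ?normr0 ?invr_ge0 //.
  rewrite normrN ger0_norm ?divr_ge0 // ler_pdivrMr ?ltr0n ?mul1r ?ler_nat; lia.
by rewrite ger0_norm ?invr_ge0.
Qed.

(** The set [T] and the pair of traces [S1 :&: T], [S2 :&: T] leave only one free
set, the common part [M] of [S1] and [S2] outside [T]. There are [4^|T|] pairs
of traces, and the sum over [M] is again at most the sum over the family,
since the family is closed under subsets. *)
Lemma sieve_square (R : realType) (m : nat) (F : {set {set 'I_m}}) :
  (forall S, S \in F -> primeset S) ->
  (forall S S' : {set 'I_m}, S \in F -> S' \subset S -> S' \in F) ->
  exists W : {set 'I_m} -> R,
   [/\ forall n, (\sum_(S in F) ramS R S n) ^+ 2 = \sum_(T : {set 'I_m}) W T * ramS R T n,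
       forall T, `|W T| <= 4 ^+ #|T| * \sum_(S in F) (phiS R S)^-1 &
       forall T, W T != 0 -> exists S1 S2, [/\ S1 \in F, S2 \in F & T \subset S1 :|: S2]].
Proof.
move=> Fp Fd; exists (fun T => \sum_(S1 in F) \sum_(S2 in F) table_coef R S1 S2 T); split.
- move=> n; rewrite expr2 mulr_suml.
  under eq_bigr do rewrite mulr_sumr.
  under [RHS]eq_bigr do rewrite mulr_suml.
  rewrite [RHS]exchange_big /=; apply: eq_bigr => S1 h1.
  under [RHS]eq_bigr do rewrite mulr_suml.
  rewrite [RHS]exchange_big /=; apply: eq_bigr => S2 h2.
  by rewrite ramS_mul //; apply: Fp.
- move=> T.
  have phi0 (S : {set 'I_m}) : 0 <= (phiS R S)^-1 by rewrite invr_ge0 prodr_ge0.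
  pose ind (S A M : {set 'I_m}) : R := (S == A :|: M)%:R.
  (* The single term A = S1 :&: T, B = S2 :&: T, M = S1 :\: T dominates. *)
  have key S1 S2 : S1 \in F -> S2 \in F -> `|table_coef R S1 S2 T| <=
    \sum_(A in powerset T) \sum_(B in powerset T) \sum_(M in F)
       ind S1 A M * ind S2 B M * (phiS R M)^-1.
    move=> h1 h2; have nn A B M : 0 <= ind S1 A M * ind S2 B M * (phiS R M)^-1.
      by rewrite !mulr_ge0.
    have [->|/table_coef_support/andP[hT /eqP e]] := eqVneq (table_coef R S1 S2 T) 0.
      by rewrite normr0; do 3!(apply: sumr_ge0 => ? _).
    apply: le_trans (table_coef_bound _ _ _ (Fp _ h1)) _.
    rewrite (bigD1 (S1 :&: T)) ?powersetE ?subsetIr //= -[leLHS]addr0.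
    apply: lerD; last by do 3!(apply: sumr_ge0 => ? _).
    rewrite (bigD1 (S2 :&: T)) ?powersetE ?subsetIr //= -[leLHS]addr0.
    apply: lerD; last by do 2!(apply: sumr_ge0 => ? _).
    have hM : S1 :\: T \in F by apply: (Fd S1) => //; exact: subsetDl.
    rewrite (bigD1 (S1 :\: T) hM) /= -[leLHS]addr0.
    apply: lerD; last by apply: sumr_ge0 => ? _.
    by rewrite /ind setID eqxx {2}e setID eqxx !mul1r.
  apply: le_trans (ler_norm_sum _ _ _) _.
  apply: (@le_trans _ _ (\sum_(S1 in F) \sum_(S2 in F)
     \sum_(A in powerset T) \sum_(B in powerset T) \sum_(M in F)
       ind S1 A M * ind S2 B M * (phiS R M)^-1)).
    apply: ler_sum => S1 h1; apply: le_trans (ler_norm_sum _ _ _) _.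
    by apply: ler_sum => S2 h2; apply: key.
  have one A M : \sum_(S in F) ind S A M <= 1.
    rewrite /ind; have [h|h] := boolP (A :|: M \in F).
      rewrite (bigD1 (A :|: M)) //= eqxx big1 ?addr0 // => S /andP[_ /negbTE->] //.
    rewrite big1 ?ler01 // => S hS; case: eqP => // e; by rewrite -e hS in h.
  have -> : \sum_(S1 in F) \sum_(S2 in F) \sum_(A in powerset T)
     \sum_(B in powerset T) \sum_(M in F) ind S1 A M * ind S2 B M * (phiS R M)^-1 =
     \sum_(A in powerset T) \sum_(B in powerset T) \sum_(M in F)
       (\sum_(S1 in F) ind S1 A M) * (\sum_(S2 in F) ind S2 B M) * (phiS R M)^-1.
    under eq_bigr do rewrite exchange_big /=.
    rewrite exchange_big /=; apply: eq_bigr => A _.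
    under eq_bigr do rewrite exchange_big /=.
    rewrite exchange_big /=; apply: eq_bigr => B _.
    under eq_bigr do rewrite exchange_big /=.
    rewrite exchange_big /=; apply: eq_bigr => M _.
    rewrite -!mulrA mulr_suml; apply: eq_bigr => S1 _.
    rewrite mulr_suml mulr_sumr; apply: eq_bigr => S2 _; by rewrite mulrA.
  apply: (@le_trans _ _ (\sum_(A in powerset T) \sum_(B in powerset T)
      \sum_(M in F) (phiS R M)^-1)).
    do 3!(apply: ler_sum => ? _).
    rewrite -[leRHS]mul1r ler_wpM2r //.
    apply: le_trans (ler_pM _ _ (one _ _) (one _ _)) _; rewrite ?mulr1 //;
    by apply: sumr_ge0 => ? _.
  rewrite !sumr_const card_powerset -mulrnA -[leLHS]mulr_natl -expnD addnn.
  by rewrite -mul2n expnM natrX.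
- move=> T /eqP h; have [/exists_inP[S1 h1 /exists_inP[S2 h2 h3]]|hn] :=
    boolP [exists S1 in F, exists S2 in F, T \subset S1 :|: S2].
    by exists S1, S2.
  case: h; apply: big1 => S1 h1; apply: big1 => S2 h2.
  apply/eqP/negP => /negP/table_coef_support/andP[h3 _].
  case/negP: hn; apply/exists_inP; exists S1 => //; apply/exists_inP; by exists S2.
Qed.

(** * Sums over sets of primes with a product of given size *)

Lemma setprod_gt0 (m : nat) (T : {set 'I_m}) : primeset T -> (0 < setprod T)%N.
Proof. by move=> h; apply: prodn_cond_gt0 => p /(primesetP h)/prime_gt0. Qed.

Lemma setprodU1 (m : nat) (p : 'I_m) (T : {set 'I_m}) : p \notin T ->
  setprod (p |: T) = (p * setprod T)%N.
Proof. by move=> h; rewrite /setprod big_setU1. Qed.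

Lemma primesetU1 (m : nat) (p : 'I_m) (T : {set 'I_m}) :
  prime p -> primeset T -> primeset (p |: T).
Proof.
move=> pp h; apply/forall_inP => q; rewrite !inE => /orP[/eqP->//|].
exact: primesetP.
Qed.

Lemma primesetS (m : nat) (D T : {set 'I_m}) : D \subset T -> primeset T -> primeset D.
Proof. by move=> /fintype.subsetP s h; apply/forall_inP => q /s; exact: primesetP. Qed.

Lemma setprodS (m : nat) (D T : {set 'I_m}) : D \subset T -> (setprod D %| setprod T)%N.
Proof.
move=> s; rewrite /setprod [X in (_ %| X)%N](big_setID D) /= (finset.setIidPr s); exact: dvdn_mulr.
Qed.

Lemma setprodU_le (m : nat) (S T : {set 'I_m}) : primeset S -> primeset T ->
  (setprod (S :|: T) <= setprod S * setprod T)%N.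
Proof.
move=> hS hT; rewrite {1}/setprod (big_setID S) /= finset.setUK -/(setprod S).
rewrite leq_mul2l finset.setDUl finset.setDv finset.set0U; apply/orP; right.
apply: dvdn_leq; first exact: setprod_gt0.
exact/setprodS/finset.subsetDl.
Qed.

Lemma prime_dvd_setprod (m : nat) (T : {set 'I_m}) (p : 'I_m) :
  primeset T -> prime p -> (p %| setprod T)%N = (p \in T).
Proof.
move=> hT pp; apply/idP/idP => [|pT]; last first.
  by rewrite /setprod (bigD1 p) //= dvdn_mulr.
rewrite /setprod; elim/big_rec: _ => [|q n qT IH].
  by rewrite Euclid_dvd1.
rewrite Euclid_dvdM // => /orP[|//].
by rewrite dvdn_prime2 ?(primesetP hT qT) // => /eqP/val_inj->.
Qed.

Lemma setprod_inj (m : nat) (S T : {set 'I_m}) : primeset S -> primeset T ->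
  setprod S = setprod T -> S = T.
Proof.
move=> hS hT e; apply/setP => p; apply/idP/idP => h.
  by rewrite -prime_dvd_setprod ?(primesetP hS h) // -e prime_dvd_setprod // (primesetP hS h).
by rewrite -prime_dvd_setprod ?(primesetP hT h) // e prime_dvd_setprod // (primesetP hT h).
Qed.

Lemma card_setprod_lt (m X : nat) (P : pred {set 'I_m}) :
  (forall T, P T -> primeset T /\ (setprod T < X)%N) -> (#|P| <= X)%N.
Proof.
case: X => [|X] h.
  by rewrite leqn0; apply/eqP/eq_card0 => T; apply/negP => /h[].
rewrite -[leqRHS]card_ord.
apply: (@leq_card_in _ _ (fun T => inord (setprod T))) => S T /h[hS lS] /h[hT lT] e.
by apply: setprod_inj => //; move/(congr1 val): e; rewrite /= !inordK.
Qed.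

Lemma powR_setprod (R : realType) (m : nat) (T : {set 'I_m}) (e : R) :
  (setprod T)%:R `^ e = \prod_(p in T) (p : nat)%:R `^ e.
Proof.
rewrite /setprod; apply: (big_ind2 (fun a b => a%:R `^ e = b)) => //.
  by rewrite powR1.
by move=> x1 x2 y1 y2 <- <-; rewrite natrM powRM.
Qed.

(** A constant to the number of prime factors is smaller than any power: a prime
larger than [K^(1/e)] is worth at least [K] by itself, and there are boundedly
many smaller ones. *)
Lemma expn_card_le (R : realType) (K e : R) : 1 <= K -> 0 < e ->
  exists2 C : R, 0 < C & forall (m : nat) (T : {set 'I_m}), primeset T ->
    K ^+ #|T| <= C * (setprod T)%:R `^ e.
Proof.
move=> K1 e0; have K0 : 0 < K by lra.
pose M := (Num.truncn (K `^ e^-1)).+1.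
have HM (n : nat) : (M <= n)%N -> K <= n%:R `^ e.
  move=> Mn; have h : K `^ e^-1 <= n%:R.
    by apply/ltW; apply: lt_le_trans (truncnS_gt _) _; rewrite ler_nat.
  have -> : K = (K `^ e^-1) `^ e by rewrite -powRrM mulVf ?gt_eqF // powRr1 // ltW.
  by rewrite ge0_ler_powR ?nnegrE ?powR_ge0 ?(ltW e0).
exists (K ^+ M) => [|m T hT]; first exact: exprn_gt0.
have -> : K ^+ #|T| = \prod_(p in T) K by rewrite prodr_const.
rewrite powR_setprod.
apply: (@le_trans _ _ (\prod_(p in T) ((if (p < M)%N then K else 1) * (p : nat)%:R `^ e))).
  apply: ler_prod => p pT; rewrite (ltW K0) /=.
  have p1 : 1 <= (p : nat)%:R `^ e :> R.
    have h1 : 1 `^ e = 1 :> R by rewrite powR1.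
    by rewrite -{1}h1 ge0_ler_powR ?nnegrE ?(ltW e0) // ler1n prime_gt0 // (primesetP hT pT).
  case: ltnP => h; last by rewrite mul1r HM.
  by rewrite -[leLHS]mulr1 ler_wpM2l // ltW.
rewrite big_split /= ler_wpM2r //; first by apply: prodr_ge0 => p _; rewrite powR_ge0.
rewrite -big_mkcondr /= prodr_const ler_weXn2l //.
rewrite -[leqRHS]card_ord; apply: (@leq_card_in _ _ (fun p : 'I_m => inord p)) => p q.
move=> /andP[_ h1] /andP[_ h2] /(congr1 val) /=.
by rewrite !inordK // => /val_inj.
Qed.

Lemma phiS_ge (R : realType) (m : nat) (T : {set 'I_m}) : primeset T ->
  (setprod T)%:R <= 2 ^+ #|T| * phiS R T.
Proof.
move=> hT; rewrite /phiS /setprod natr_prod -[2 ^+ _]prodr_const -big_split /=.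
apply: ler_prod => p pT; rewrite ler0n /= -natrM ler_nat.
by have := prime_gt1 (primesetP hT pT); lia.
Qed.

Lemma phiS_gt0 (R : realType) (m : nat) (T : {set 'I_m}) : primeset T -> 0 < phiS R T.
Proof.
move=> hT; apply: prodr_gt0 => p /(primesetP hT)/prime_gt1 h.
by rewrite ltr0n; lia.
Qed.

Definition prime_class (m s : nat) : {set {set 'I_m}} :=
  [set T | primeset T && (2 ^ s <= setprod T < 2 ^ s.+1)%N].

Lemma prime_classP (m s : nat) (T : {set 'I_m}) : T \in prime_class m s ->
  [/\ primeset T, (2 ^ s <= setprod T)%N & (setprod T < 2 ^ s.+1)%N].
Proof. by rewrite inE => /and3P[]. Qed.

Lemma sum_prime_class (R : realType) (K e : R) : 1 <= K -> 0 < e ->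
  exists2 C : R, 0 < C & forall m s : nat,
    \sum_(T in prime_class m s) K ^+ #|T| <= C * 2 ^+ s * (2 ^+ s) `^ e.
Proof.
move=> K1 e0; have [C C0 H] := expn_card_le K1 e0.
exists (2 * C * 2 `^ e) => [|m s]; first by rewrite !mulr_gt0 ?powR_gt0.
apply: (@le_trans _ _ (\sum_(T in prime_class m s) C * (2 ^+ s.+1) `^ e)).
  apply: ler_sum => T /prime_classP[hT h1 h2]; apply: le_trans (H m T hT) _.
  rewrite ler_pM2l // ge0_ler_powR ?nnegrE ?(ltW e0) ?exprn_ge0 //.
  by rewrite -natrX ler_nat ltnW.
rewrite sumr_const -[leLHS]mulr_natl.
have h : (#|prime_class m s| <= 2 ^ s.+1)%N.
  by apply: card_setprod_lt => T /prime_classP[].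
apply: (@le_trans _ _ ((2 ^ s.+1)%:R * (C * (2 ^+ s.+1) `^ e))).
  by rewrite ler_wpM2r ?ler_nat // mulr_ge0 ?powR_ge0 // ltW.
rewrite natrX exprS powRM ?exprn_ge0 //.
by rewrite le_eqVlt; apply/orP; left; apply/eqP; ring.
Qed.

Lemma phiS_inv_le (R : realType) (m s : nat) (T : {set 'I_m}) :
  primeset T -> (2 ^ s <= setprod T)%N -> (phiS R T)^-1 <= 2 ^+ #|T| / 2 ^+ s.
Proof.
move=> hT h1; have p0 := phiS_gt0 R hT.
rewrite ler_pdivlMr ?exprn_gt0 // ler_pdivrMl // mulrC.
by apply: le_trans (phiS_ge R hT); rewrite -natrX ler_nat.
Qed.

Lemma sum_prime_class_phi (R : realType) (K e : R) : 1 <= K -> 0 < e ->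
  exists2 C : R, 0 < C & forall m s : nat,
    \sum_(T in prime_class m s) K ^+ #|T| / phiS R T <= C * (2 ^+ s) `^ e.
Proof.
move=> K1 e0; have K0 : 0 <= K by lra.
have [C C0 H] := @sum_prime_class R (2 * K) e ltac:(lra) e0.
exists C => // m s.
apply: (@le_trans _ _ (\sum_(T in prime_class m s) (2 * K) ^+ #|T| * (2 ^+ s)^-1)).
  apply: ler_sum => T /prime_classP[hT h1 h2].
  rewrite exprMn; have -> : 2 ^+ #|T| * K ^+ #|T| / 2 ^+ s =
    K ^+ #|T| * (2 ^+ #|T| / 2 ^+ s) by ring.
  by rewrite ler_wpM2l ?exprn_ge0 // phiS_inv_le.
rewrite -mulr_suml ler_pdivrMr ?exprn_gt0 //; apply: le_trans (H m s) _.
by rewrite mulrAC.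
Qed.

Lemma sum_prime_class_phi2 (R : realType) (K e : R) : 1 <= K -> 0 < e ->
  exists2 C : R, 0 < C & forall m s : nat,
    \sum_(T in prime_class m s) K ^+ #|T| / phiS R T ^+ 2 <= C * (2 ^+ s) `^ e / 2 ^+ s.
Proof.
move=> K1 e0; have K0 : 0 <= K by lra.
have [C C0 H] := @sum_prime_class_phi R (2 * K) e ltac:(lra) e0.
exists C => // m s.
apply: (@le_trans _ _ (\sum_(T in prime_class m s) (2 * K) ^+ #|T| / phiS R T * (2 ^+ s)^-1)).
  apply: ler_sum => T /prime_classP[hT h1 h2].
  rewrite expr2 invfM mulrA exprMn.
  have -> : 2 ^+ #|T| * K ^+ #|T| / phiS R T / 2 ^+ s =
    K ^+ #|T| / phiS R T * (2 ^+ #|T| / 2 ^+ s) by ring.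
  by rewrite ler_wpM2l ?phiS_inv_le // divr_ge0 ?exprn_ge0 // ltW // phiS_gt0.
rewrite -mulr_suml ler_pM2r ?invr_gt0 ?exprn_gt0 //; exact: H.
Qed.

(** * The Selberg majorant of the primes *)

(** Strong induction: divide by the least prime factor, then toggle its membership
in [S]; if it was there already, it moves into the square. *)
Lemma squarefree_decomp (m n : nat) : (0 < n < m)%N ->
  exists (S : {set 'I_m}) (t : nat),
    [/\ primeset S, (0 < t)%N & n = (setprod S * t ^ 2)%N].
Proof.
have [k] := ubnP n; elim: k n => // k IH n; rewrite ltnS => nk /andP[n0 nm].
have [n1|n1] := leqP n 1.
  exists finset.set0, 1%N; split => //; first by apply/forall_inP => p; rewrite inE.
  rewrite /setprod big_set0; lia.
have pp := pdiv_prime n1; have pn := pdiv_dvd n; have p1 := prime_gt1 pp.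
have e : n = (pdiv n * (n %/ pdiv n))%N by rewrite mulnC divnK.
have q0 : (0 < n %/ pdiv n)%N by rewrite divn_gt0 ?pdiv_gt0 // dvdn_leq.
have qn : (n %/ pdiv n < n)%N by rewrite ltn_Pdiv.
have [S [t [hS t0 et]]] := IH (n %/ pdiv n)%N ltac:(lia) ltac:(lia).
have pm : (pdiv n < m)%N by apply: leq_ltn_trans nm; exact: dvdn_leq.
have [pS|pS] := boolP (Ordinal pm \in S).
  exists (S :\ Ordinal pm), (pdiv n * t)%N; split.
  - by apply: primesetS hS; exact: subsetDl.
  - by rewrite muln_gt0 pdiv_gt0.
  rewrite [LHS]e et /setprod (big_setD1 _ pS) /=; ring.
exists (Ordinal pm |: S), t; split => //; first exact: primesetU1.
by rewrite setprodU1 //= -mulnA -et.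
Qed.

Lemma sum_inv_sq (R : realType) (n : nat) :
  \sum_(t < n) ((t.+1)%:R ^+ 2)^-1 <= 2 :> R.
Proof.
case: n => [|n]; first by rewrite big_ord0.
suff : \sum_(t < n.+1) ((t.+1)%:R ^+ 2)^-1 <= 2 - (n.+1)%:R^-1 :> R.
  by move=> h; apply: le_trans h _; rewrite gerBl invr_ge0.
elim: n => [|n IH]; first by rewrite big_ord_recl big_ord0 expr1n invr1; lra.
rewrite big_ord_recr /=; apply: le_trans (lerD IH (lexx _)) _.
have -> : (n.+2)%:R = (n.+1)%:R + 1 :> R by rewrite -addn1 natrD.
have : 0 < (n.+1)%:R :> R by rewrite ltr0n.
move: (n.+1)%:R => x x0.
have -> : ((x + 1) ^+ 2)^-1 = (x * (x + 1))^-1 - (x * (x + 1) ^+ 2)^-1.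
  by field; rewrite !gt_eqF //; lra.
have -> : (x * (x + 1))^-1 = x^-1 - (x + 1)^-1 by field; rewrite !gt_eqF //; lra.
have : 0 <= (x * (x + 1) ^+ 2)^-1 by rewrite invr_ge0 mulr_ge0 ?exprn_ge0 //; lra.
lra.
Qed.

Lemma harmonic_pow2 (R : realType) (j : nat) :
  1 + j%:R / 2 <= \sum_(i < 2 ^ j) (i.+1)%:R^-1 :> R.
Proof.
elim: j => [|j IH].
  by rewrite expn0 big_ord_recl big_ord0 invr1 mul0r addr0.
rewrite -(big_mkord predT (fun i => (i.+1)%:R^-1)).
rewrite expnS mul2n -addnn (big_cat_nat (leq0n _) (leq_addr _ _)) /= big_mkord.
have h : 2^-1 <= \sum_(2 ^ j <= i < 2 ^ j + 2 ^ j) (i.+1)%:R^-1 :> R.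
  rewrite sum_shift; apply: (@le_trans _ _ (\sum_(i < 2 ^ j) ((2 * 2 ^ j)%:R^-1 : R))).
    by rewrite sumr_const card_ord -[leRHS]mulr_natl natrM invfM mulrCA divff ?mulr1 // pnatr_eq0 expn_eq0.
  apply: ler_sum => i _; rewrite lef_pV2 ?posrE ?ltr0n ?ler_nat ?muln_gt0 ?expn_gt0 //.
  have := ltn_ord i; lia.
rewrite -natr1; lra.
Qed.

Definition small_prime_sets (m Q : nat) : {set {set 'I_m}} :=
  [set S | primeset S && (setprod S <= Q)%N].

Lemma phiS_le (R : realType) (m : nat) (T : {set 'I_m}) : primeset T ->
  phiS R T <= (setprod T)%:R.
Proof.
move=> hT; rewrite /phiS /setprod natr_prod.
by apply: ler_prod => p pT; rewrite ler0n ler_nat leq_pred.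
Qed.

(** Write every [i <= Q] as a squarefree number times a square and use that the
inverse squares sum to at most 2. The logarithmic size of the left side is the
only input on the distribution of primes in the upper bound. *)
Lemma sieve_mass_ge (R : realType) (m Q : nat) : (Q < m)%N ->
  \sum_(i < Q) (i.+1)%:R^-1 <= 2 * \sum_(S in small_prime_sets m Q) (phiS R S)^-1.
Proof.
move=> Qm.
pose ind (i : 'I_Q) (S : {set 'I_m}) (t : 'I_Q) : R := (i.+1 == setprod S * t.+1 ^ 2)%N%:R.
pose v (S : {set 'I_m}) (t : 'I_Q) : R := (setprod S * t.+1 ^ 2)%:R^-1.
have v0 S t : 0 <= v S t by rewrite invr_ge0.
apply: (@le_trans _ _ (\sum_(i < Q) \sum_(S in small_prime_sets m Q) \sum_(t < Q) ind i S t * v S t)).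
  apply: ler_sum => i _; have iQ := ltn_ord i.
  have [S [t [hS t0 e]]] := @squarefree_decomp m i.+1 ltac:(lia).
  have sle : (setprod S <= i.+1)%N by rewrite e leq_pmulr // expn_gt0 t0.
  have tle : (t.-1 < Q)%N.
    have : (t <= i.+1)%N by rewrite e (leq_trans (leq_pexp2l t0 (isT : 0 < 2)%N)) // leq_pmull // setprod_gt0.
    by lia.
  rewrite (bigD1 S) /=; last by rewrite inE hS (leq_trans sle).
  rewrite (bigD1 (Ordinal tle)) //= /ind /v /= prednK // -e eqxx mul1r -!addrA lerDl.
  by rewrite addr_ge0 //; do ?[apply: sumr_ge0 => ? _]; rewrite mulr_ge0 ?invr_ge0.
rewrite exchange_big mulr_sumr /=; apply: ler_sum => S; rewrite inE => /andP[hS _].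
rewrite exchange_big /=.
apply: (@le_trans _ _ (\sum_(t < Q) v S t)).
  apply: ler_sum => t _; rewrite -mulr_suml -[leRHS]mul1r ler_wpM2r //.
  rewrite /ind; case: (boolP [exists i : 'I_Q, i.+1 == (setprod S * t.+1 ^ 2)%N]).
    move=> /existsP[i hi]; rewrite (bigD1 i) //= hi big1 ?addr0 // => k ki.
    case: eqP => // hk; case/eqP: ki; apply/val_inj; move/eqP: hi; rewrite /=; lia.
  move=> /existsPn h; rewrite big1 ?ler01 // => k _; by rewrite (negbTE (h k)).
rewrite /v; under eq_bigr do rewrite natrM invfM natrX.
rewrite -mulr_sumr mulrC; apply: ler_pM; rewrite ?sum_inv_sq ?invr_ge0 ?sumr_ge0 //.
  have p1 := phiS_gt0 R hS.
  have p2 : 0 < (setprod S)%:R :> R by rewrite ltr0n setprod_gt0.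
  by rewrite lef_pV2 ?posrE // phiS_le.
Qed.

(** At a prime [q > 2 ^ j] no prime of a set in the family divides [q], so the sieve
sum equals the mass, and its square divided by the mass is the mass itself. *)
Lemma selberg_weight (R : realType) (m j : nat) : (2 ^ j < m)%N ->
  exists w : {set 'I_m} -> R,
   [/\ forall T, `|w T| <= 4 ^+ #|T|,
       forall T, w T != 0 -> primeset T && (setprod T <= 2 ^ (2 * j))%N,
       forall n, 0 <= \sum_(T : {set 'I_m}) w T * ramS R T n &
       forall q, prime q -> (2 ^ j < q)%N ->
         (j.+1)%:R <= 4 * \sum_(T : {set 'I_m}) w T * ramS R T q].
Proof.
move=> jm; pose F := small_prime_sets m (2 ^ j); pose G : R := \sum_(S in F) (phiS R S)^-1.
have Fp (S : {set 'I_m}) : S \in F -> primeset S by rewrite inE => /andP[].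
have Fd (S S' : {set 'I_m}) : S \in F -> S' \subset S -> S' \in F.
  rewrite !inE => /andP[h1 h2] s; rewrite (primesetS s h1) /=.
  by apply: leq_trans h2; rewrite dvdn_leq ?setprod_gt0 ?setprodS.
have Gj : (j.+1)%:R <= 4 * G.
  have h1 : \sum_(i < 2 ^ j) (i.+1)%:R^-1 <= 2 * G := sieve_mass_ge R jm.
  have h2 := harmonic_pow2 R j; have h3 := le_trans h2 h1.
  have h4 : 0 <= j%:R :> R by [].
  by rewrite -natr1; move: h3 h4 {h1 h2}; move: j%:R G => x y; lra.
have G0 : 0 < G by have : 0 < (j.+1)%:R :> R by []; lra.
have [W [W1 W2 W3]] := @sieve_square R m F Fp Fd.
have E n : \sum_(T : {set 'I_m}) W T / G * ramS R T n = (\sum_(S in F) ramS R S n) ^+ 2 / G.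
  by rewrite W1 mulr_suml; apply: eq_bigr => T _; rewrite mulrAC.
exists (fun T => W T / G); split.
- by move=> T; rewrite normrM normfV (gtr0_norm G0) ler_pdivrMr //; exact: W2.
- move=> T; rewrite mulf_eq0 negb_or => /andP[/W3[S1 [S2 [h1 h2 s]]] _].
  have p12 : primeset (S1 :|: S2).
    by apply/forall_inP => p; rewrite inE => /orP[]; [exact: primesetP (Fp _ h1)|exact: primesetP (Fp _ h2)].
  rewrite (primesetS s p12) /=.
  apply: leq_trans (dvdn_leq (setprod_gt0 p12) (setprodS s)) _.
  apply: leq_trans (setprodU_le (Fp _ h1) (Fp _ h2)) _.
  move: h1 h2; rewrite !inE mul2n -addnn expnD => /andP[_ h1] /andP[_ h2].
  exact: leq_mul.
- by move=> n; rewrite E divr_ge0 ?sqr_ge0 ?ltW.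
move=> q pq jq; rewrite E.
have -> : \sum_(S in F) ramS R S q = G.
  apply: eq_bigr => S SF; rewrite /ramS /phiS -prodfV; apply: eq_bigr => p pS.
  rewrite /ram ifF //; apply/negP => pdq.
  have hp := primesetP (Fp _ SF) pS.
  move: pdq; rewrite dvdn_prime2 // => /eqP e.
  move: SF; rewrite inE => /andP[hS]; apply/negP; rewrite -ltnNge.
  apply: leq_trans jq _; rewrite -e dvdn_leq ?setprod_gt0 //.
  by rewrite prime_dvd_setprod.
by rewrite expr2 mulfK // gt_eqF.
Qed.

(** * Correlations of normalised Ramanujan sums *)

Lemma periodic_modn (T : Type) (P : nat) (h : nat -> T) (i : nat) :
  (forall i, h (i + P)%N = h i) -> h (i %% P)%N = h i.
Proof.
move=> hP; rewrite {2}(divn_eq i P) addnC.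
by elim: (i %/ P)%N => [|k IH]; rewrite ?mul0n ?addn0 // mulSnr addnA hP.
Qed.

(** Split [len] into full periods and a remainder shorter than one period. *)
Lemma periodic_sum (R : realType) (P len : nat) (h : nat -> R) : (0 < P)%N ->
  (forall i, h (i + P)%N = h i) -> (forall i, `|h i| <= 1) ->
  `|\sum_(i < len) h i| <= len%:R * (`|\sum_(i < P) h i| / P%:R) + P%:R.
Proof.
move=> P0 hP h1.
have hk k i : h (P * k + i)%N = h i.
  by rewrite -(periodic_modn _ hP) -(periodic_modn i hP) mulnC modnMDl.
have E : \sum_(i < len) h i = (len %/ P)%:R * (\sum_(i < P) h i) + \sum_(i < len %% P) h i.
  rewrite -(big_mkord predT h) {1}(divn_eq len P).
  rewrite (big_cat_nat (leq0n _) (leq_addr _ _)) /= big_mkord mulnC.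
  rewrite (sum_residues P (len %/ P) h) exchange_big /= sum_shift; congr (_ + _).
    under eq_bigr => k _ do under eq_bigr => r _ do rewrite addnC hk.
    by rewrite sumr_const card_ord mulr_natl.
  by apply: eq_bigr => i _; rewrite hk.
rewrite E; apply: le_trans (ler_normD _ _) _; apply: lerD.
  rewrite normrM normr_nat mulrCA mulrC ler_wpM2l //.
  by rewrite ler_pdivlMr ?ltr0n // -natrM ler_nat leq_trunc_div.
apply: le_trans (ler_norm_sum _ _ _) _.
apply: (@le_trans _ _ (\sum_(i < len %% P) 1)); first exact: ler_sum.
by rewrite sumr_const card_ord ler_nat ltnW // ltn_mod.
Qed.

Lemma periodic_reindex (R : realType) (P b r : nat) (h : nat -> R) : (0 < P)%N ->
  coprime b P -> (forall i, h (i + P)%N = h i) ->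
  \sum_(k < P) h (r + b * k)%N = \sum_(k < P) h k.
Proof.
move=> P0 cop hP; case: P P0 cop hP => // P _ cop hP.
have inj : injective (fun k : 'I_P.+1 => inord ((r + b * k) %% P.+1)%N : 'I_P.+1).
  move=> k l /(congr1 val) /=; rewrite !inordK ?ltn_mod // => /eqP.
  rewrite eqn_modDl; wlog kl : k l / (k <= l)%N.
    move=> H; case: (leqP k l) => hkl; first exact: H.
    by rewrite eq_sym => h'; symmetry; apply: H h'; exact: ltnW.
  rewrite eq_sym eqn_mod_dvd; last by rewrite leq_mul2l kl orbT.
  rewrite -mulnBr Gauss_dvdr; last by rewrite coprime_sym.
  move=> d; apply/val_inj => /=; have := ltn_ord l.
  have [hlk|hlk] := posnP (l - k)%N; first by lia.
  by have := dvdn_leq hlk d; lia.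
rewrite [RHS](reindex_inj inj) /=; apply: eq_bigr => k _.
by rewrite inordK ?ltn_mod // (periodic_modn _ hP).
Qed.

(** Chinese remainder theorem: along each residue class modulo [b], the other
function runs over all its residues. *)
Lemma crt_sum (R : realType) (a b : nat) (F G : nat -> R) : (0 < a)%N -> (0 < b)%N ->
  coprime a b -> (forall i, F (i + a)%N = F i) -> (forall i, G (i + b)%N = G i) ->
  \sum_(i < a * b) F i * G i = (\sum_(i < a) F i) * (\sum_(i < b) G i).
Proof.
move=> a0 b0 cop hF hG; rewrite mulnC (sum_residues b a (fun i => F i * G i)).
rewrite mulr_sumr; apply: eq_bigr => r _.
have hk k : G (r + b * k)%N = G r.
  by rewrite -(periodic_modn _ hG) -(periodic_modn r hG) mulnC addnC modnMDl.
under eq_bigr do rewrite hk.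
by rewrite -mulr_suml (periodic_reindex r a0) // coprime_sym.
Qed.

Lemma coprime_setprod (m : nat) (p : 'I_m) (T : {set 'I_m}) : primeset T -> prime p ->
  p \notin T -> coprime p (setprod T).
Proof. by move=> hT pp pT; rewrite prime_coprime // prime_dvd_setprod. Qed.

Lemma crt_prod (R : realType) (m : nat) (U : {set 'I_m}) (h : 'I_m -> nat -> R) :
  primeset U -> (forall p i, h p (i + p)%N = h p i) ->
  \sum_(i < setprod U) \prod_(p in U) h p i = \prod_(p in U) \sum_(i < p) h p i.
Proof.
move=> hU hp; have [k] := ubnP #|U|; elim: k U hU => // k IH U hU; rewrite ltnS => Uk.
have [->|[p pU]] := set_0Vmem U.
  by rewrite big_set0 /setprod big_set0 big_ord_recl big_ord0 addr0 big_set0.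
have hD : primeset (U :\ p) by apply: primesetS hU; exact: subsetDl.
have hpp := primesetP hU pU.
have pD : p \notin U :\ p by rewrite !inE eqxx.
have e : setprod U = (p * setprod (U :\ p))%N by rewrite /setprod (big_setD1 _ pU).
rewrite e [RHS](big_setD1 _ pU) /= -IH //; last by move: Uk; rewrite (cardsD1 p) pU; lia.
rewrite -(@crt_sum R p (setprod (U :\ p)) (h p) (fun i => \prod_(q in U :\ p) h q i))
  ?setprod_gt0 ?prime_gt0 //; last 2 first.
- exact: coprime_setprod.
- move=> i; apply: eq_bigr => q qD.
  have : (q %| setprod (U :\ p))%N by rewrite prime_dvd_setprod ?(primesetP hD qD).
  move=> /dvdnP[c ->]; elim: c => [|c IHc]; first by rewrite mul0n addn0.
  by rewrite mulSnr addnA hp.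
by apply: eq_bigr => i _; rewrite (big_setD1 _ pU).
Qed.

Lemma ramE (R : realType) (p n : nat) : prime p ->
  ram R p n = (1 - p%:R * (p %| n)%N%:R) / (p.-1)%:R.
Proof.
move=> pp; have p1 := prime_gt1 pp; rewrite /ram.
have e1 : (p.-1)%:R = p%:R - 1 :> R by rewrite -subn1 natrB // ltnW.
have h1 : p%:R - 1 != 0 :> R by rewrite -e1 pnatr_eq0; lia.
by rewrite e1; case: (p %| n)%N; rewrite ?mulr1 ?mulr0; field.
Qed.

Lemma ram_norm_le1 (R : realType) (p n : nat) : prime p -> `|ram R p n| <= 1.
Proof.
move=> /prime_gt1 h; rewrite /ram; case: ifP => _; first by rewrite normrN1.
by rewrite normfV normr_nat invf_le1 ?ltr0n ?ler1n; lia.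
Qed.

Lemma sum_dvd (R : realType) (p a : nat) : (0 < p)%N ->
  \sum_(i < p) (p %| i + a)%N%:R = 1 :> R.
Proof.
move=> p0; have := @periodic_reindex R p 1 a (fun i => (p %| i)%N%:R) p0 (coprime1n _).
move=> /(_ (fun i => _)) h.
under eq_bigr do rewrite addnC -[X in (a + X)%N]mul1n.
rewrite h => [|i]; last by rewrite dvdn_addl.
case: p p0 {h} => // p _; rewrite big_ord_recl dvdn0 big1 ?addr0 // => i _.
by rewrite gtnNdvd //= /bump /=; have := ltn_ord i; lia.
Qed.

Lemma sum_ram (R : realType) (p a : nat) : prime p -> \sum_(i < p) ram R p (i + a) = 0.
Proof.
move=> pp; under eq_bigr do rewrite (ramE _ _ pp).
rewrite -mulr_suml big_split /= sumrN -mulr_sumr sum_dvd ?prime_gt0 // sumr_const card_ord.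
by rewrite mulr1 subrr mul0r.
Qed.

(** By the mean zero property only the diagonal and the collision of the two roots
survive. *)
Lemma sum_ram_corr (R : realType) (p a b : nat) : prime p ->
  `|\sum_(i < p) ram R p (i + a) * ram R p (i + b)| <=
    p%:R * ((1 + p%:R * (a == b %[mod p])%:R) / (p.-1)%:R ^+ 2).
Proof.
move=> pp; have p0 := prime_gt0 pp.
have -> : \sum_(i < p) ram R p (i + a) * ram R p (i + b) =
  p%:R * (p%:R * (a == b %[mod p])%:R - 1) / (p.-1)%:R ^+ 2.
  have E (i : nat) : ram R p (i + a) * ram R p (i + b) =
    (1 - p%:R * (p %| i + a)%N%:R - p%:R * (p %| i + b)%N%:R
     + p%:R ^+ 2 * (a == b %[mod p])%:R * (p %| i + a)%N%:R) / (p.-1)%:R ^+ 2.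
    rewrite !(ramE _ _ pp).
    have -> : p%:R ^+ 2 * (a == b %[mod p])%:R * (p %| i + a)%N%:R =
       p%:R ^+ 2 * ((p %| i + a)%N%:R * (p %| i + b)%N%:R) :> R.
      rewrite -mulrA; congr (_ * _); rewrite -!natrM !mulnb; congr (_%:R); congr nat_of_bool.
      rewrite andbC; case: (boolP (p %| i + a)%N) => //= da.
      rewrite -(eqn_modDl i); rewrite /dvdn in da *.
      by rewrite (eqP da) eq_sym.
    rewrite expr2 invfM; ring.
  under eq_bigr do rewrite E.
  rewrite -mulr_suml !big_split /= !sumrN -!mulr_sumr !sum_dvd // sumr_const card_ord.
  congr (_ / _); ring.
rewrite -mulrA normrM normr_nat ler_wpM2l // normrM [X in _ * X]ger0_norm ?invr_ge0 ?exprn_ge0 //.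
rewrite ler_wpM2r ?invr_ge0 ?exprn_ge0 //.
apply: le_trans (ler_normB _ _) _; rewrite normr1 addrC lerD2l ger0_norm //.
Qed.

Lemma ramS_norm_le1 (R : realType) (m : nat) (T : {set 'I_m}) (n : nat) :
  primeset T -> `|ramS R T n| <= 1.
Proof.
move=> hT; rewrite /ramS normr_prod; apply: prodr_ile1 => p pT.
by rewrite normr_ge0 ram_norm_le1 // (primesetP hT pT).
Qed.

(** For [T <> T'] some prime lies in exactly one of the two sets, and its factor
has mean zero over a period; for [T = T'] the mean is a product of the local
correlations. The last term is the length of a period. *)
Lemma ramS_corr (R : realType) (m : nat) (T T' : {set 'I_m}) (a b len : nat) :
  primeset T -> primeset T' ->
  `|\sum_(i < len) ramS R T (i + a) * ramS R T' (i + b)| <=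
   len%:R * ((T == T')%:R * \prod_(p in T) ((1 + (p : nat)%:R * (a == b %[mod p])%:R) / (p.-1)%:R ^+ 2))
   + (setprod T)%:R * (setprod T')%:R.
Proof.
move=> hT hT'.
pose U := T :|: T'.
pose h (p : 'I_m) (i : nat) : R := (if p \in T then ram R p (i + a) else 1) *
                         (if p \in T' then ram R p (i + b) else 1).
have hU : primeset U.
  by apply/forall_inP => p; rewrite inE => /orP[]; [exact: primesetP hT|exact: primesetP hT'].
have eper p n c : ram R p (n + p + c) = ram R p (n + c).
  by rewrite /ram addnAC dvdn_addl.
have hper (p : 'I_m) i : h p (i + p)%N = h p i by rewrite /h !eper.
have E i : ramS R T (i + a) * ramS R T' (i + b) = \prod_(p in U) h p i.
  rewrite big_split /= -!big_mkcondr /ramS; congr (_ * _); apply: eq_bigl => p;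
  by rewrite inE; case: (p \in T); case: (p \in T').
have per i : \prod_(p in U) h p (i + setprod U)%N = \prod_(p in U) h p i.
  apply: eq_bigr => q qD.
  have : (q %| setprod U)%N by rewrite prime_dvd_setprod ?(primesetP hU qD).
  move=> /dvdnP[c ->]; elim: c => [|c IHc]; first by rewrite mul0n addn0.
  by rewrite mulSnr addnA hper.
have -> : \sum_(i < len) ramS R T (i + a) * ramS R T' (i + b) =
  \sum_(i < len) \prod_(p in U) h p i by apply: eq_bigr => i _; exact: E.
apply: le_trans (periodic_sum len (setprod_gt0 hU) per _) _.
  by move=> i; rewrite -E normrM mulr_ile1 ?normr_ge0 ?ramS_norm_le1.
apply: lerD; last by rewrite -natrM ler_nat setprodU_le.
rewrite ler_wpM2l // crt_prod //.
have [e|ne] := eqVneq T T'; last first.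
  rewrite mul0r.
  have [p pU hp] : exists2 p, p \in U & \sum_(i < p) h p i = 0.
    have [p hp] : exists p, (p \in T) != (p \in T').
      apply/existsP; apply: contraNT ne => /existsPn hh; apply/eqP/setP => p.
      by have := hh p; rewrite negbK => /eqP.
    exists p; first by rewrite inE; case: (p \in T) (p \in T') hp => [] [].
    rewrite /h; case: (boolP (p \in T)) (boolP (p \in T')) hp => [h1|h1] [h2|h2] // _.
      by under eq_bigr do rewrite mulr1; rewrite sum_ram // (primesetP hT h1).
    by under eq_bigr do rewrite mul1r; rewrite sum_ram // (primesetP hT' h2).
  by rewrite (bigD1 p) //= hp mul0r normr0 mul0r.
rewrite mul1r normr_prod /setprod natr_prod -prodfV -big_split /=.
rewrite /U -e finset.setUid; apply: ler_prod => p pT.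
have pp := primesetP hT pT.
rewrite divr_ge0 //= ler_pdivrMr ?ltr0n ?prime_gt0 // mulrC /h -e pT.
exact: sum_ram_corr.
Qed.

(** * Pieces of the majorant: bounds with a small loss *)

(** Convexity of the power in the form of Young's inequality against the mean
[M]: the term [y * M `^ (p - 1)] is at most a combination of [y `^ p] and
[M `^ p]. *)
Lemma jensen_powR (R : realType) (I : finType) (P : pred I) (c F : I -> R) (p : R) : 1 < p ->
  (forall i, P i -> 0 <= c i) -> (forall i, P i -> 0 <= F i) ->
  (\sum_(i | P i) c i * F i) `^ p <=
    (\sum_(i | P i) c i) `^ (p - 1) * \sum_(i | P i) c i * F i `^ p.
Proof.
move=> p1 c0 F0; have p0 : 0 < p by lra.
set W := \sum_(i | P i) c i; set S := \sum_(i | P i) c i * F i.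
set V := \sum_(i | P i) _ * _ `^ _.
have W0 : 0 <= W by apply: sumr_ge0.
have S0 : 0 <= S by apply: sumr_ge0 => i Pi; rewrite mulr_ge0 ?c0 ?F0.
have V0 : 0 <= V by apply: sumr_ge0 => i Pi; rewrite mulr_ge0 ?c0 ?powR_ge0.
have [W1|W1] := eqVneq W 0.
  have -> : S = 0.
    rewrite /S big1 // => i Pi; apply/eqP; rewrite mulf_eq0; apply/orP; left.
    by move/eqP: W1; rewrite psumr_eq0 // => /allP /(_ i); rewrite mem_index_enum Pi; exact.
  by rewrite powR0 ?gt_eqF // mulr_ge0 ?powR_ge0.
have {W1}W0 : 0 < W by rewrite lt_neqAle eq_sym W1.
pose M := S / W; have M0 : 0 <= M by rewrite divr_ge0 // ltW.
have SWM : S = W * M by rewrite /M mulrCA divff ?mulr1 // gt_eqF.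
have young y : 0 <= y -> y * M `^ (p - 1) <= y `^ p / p + (1 - p^-1) * M `^ p.
  move=> y0; pose q := (1 - p^-1)^-1.
  have ip : p^-1 < 1 by rewrite invf_lt1.
  have q0 : 0 < q by rewrite invr_gt0; lra.
  have := @conjugate_powR R y (M `^ (p - 1)) p q y0 (powR_ge0 _ _) p0 q0.
  rewrite /q invrK -powRrM => h; apply: le_trans (h _) _; first by ring.
  have -> : (p - 1) * (1 - p^-1)^-1 = p.
    have e : 1 - p^-1 = (p - 1) / p by field; rewrite gt_eqF.
    by rewrite e invf_div mulrCA divff ?mulr1 // gt_eqF //; lra.
  by rewrite [X in _ + X]mulrC.
have key : W * M `^ p <= V.
  have : S * M `^ (p - 1) <= V / p + (1 - p^-1) * (W * M `^ p).
    rewrite /S /V /W !mulr_suml mulr_sumr -big_split /=; apply: ler_sum => i Pi.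
    have := ler_wpM2l (c0 i Pi) (young _ (F0 i Pi)); rewrite mulrA.
    by move=> h; apply: le_trans h _; rewrite le_eqVlt; apply/orP; left; apply/eqP; ring.
  have e : S * M `^ (p - 1) = W * M `^ p.
    by rewrite SWM -mulrA mulr_powRB1.
  rewrite e; move: (W * _) => U h.
  have : U * p^-1 <= V * p^-1 by lra.
  by rewrite ler_pM2r ?invr_gt0.
rewrite SWM powRM ?(ltW W0) // -(mulr_powRB1 (ltW W0) p0) [W * _]mulrC -mulrA.
by rewrite ler_wpM2l ?powR_ge0.
Qed.

Lemma weighted_minkowski (R : realType) (I : finType) (P : pred I) (c : I -> R)
    (L : nat) (F : I -> nat -> R) (p B : R) : 1 < p ->
  (forall i, P i -> 0 <= c i) -> (forall i x, P i -> 0 <= F i x) ->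
  (forall i, P i -> \sum_(x < L) F i x `^ p <= B) ->
  \sum_(x < L) (\sum_(i | P i) c i * F i x) `^ p <= (\sum_(i | P i) c i) `^ p * B.
Proof.
move=> p1 c0 F0 H; have p0 : 0 < p by lra.
set W := \sum_(i | P i) c i; have W0 : 0 <= W by apply: sumr_ge0.
apply: (@le_trans _ _ (\sum_(x < L) W `^ (p - 1) * \sum_(i | P i) c i * F i x `^ p)).
  by apply: ler_sum => x _; apply: jensen_powR => // i Pi; exact: F0.
rewrite -mulr_sumr exchange_big /= -(mulr_powRB1 W0 p0) [W * _]mulrC -mulrA.
rewrite ler_wpM2l ?powR_ge0 // mulr_suml; apply: ler_sum => i Pi.
by rewrite -mulr_sumr ler_wpM2l ?c0 ?H.
Qed.

Lemma prod_subset_expand (R : realType) (m : nat) (T : {set 'I_m}) (F : 'I_m -> R) :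
  \prod_(p in T) (1 + F p) = \sum_(D in powerset T) \prod_(p in D) F p.
Proof.
have -> : \prod_(p in T) (1 + F p) = \prod_p ((if p \in T then F p else 0) + 1).
  rewrite big_mkcond; apply: eq_bigr => p _; case: ifP => _; first by rewrite addrC.
  by rewrite add0r.
rewrite bigA_distr /= [RHS]big_mkcond /=; apply: eq_bigr => D _.
rewrite powersetE; case: ifP => h.
  rewrite [RHS]big_mkcond; apply: eq_bigr => p _; case: ifP => // pD.
  by rewrite (fintype.subsetP h p pD).
have /subsetPn[p pD pT] : ~~ (D \subset T) by rewrite h.
by rewrite (bigD1 p) //= pD (negbTE pT) mul0r.
Qed.

Lemma setprod_dvd (m n : nat) (D : {set 'I_m}) : primeset D ->
  (forall p, p \in D -> (p %| n)%N) -> (setprod D %| n)%N.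
Proof.
have [k] := ubnP #|D|; elim: k D => // k IH D; rewrite ltnS => Dk hD H.
have [->|[p pD]] := set_0Vmem D; first by rewrite /setprod big_set0 dvd1n.
have hD' : primeset (D :\ p) by apply: primesetS hD; exact: subsetDl.
have -> : setprod D = (p * setprod (D :\ p))%N by rewrite /setprod (big_setD1 _ pD).
have pp := primesetP hD pD.
rewrite Gauss_dvd; last by apply: coprime_setprod => //; rewrite !inE eqxx.
rewrite H //= IH //; first by move: Dk; rewrite (cardsD1 p) pD; lia.
by move=> q; rewrite inE => /andP[_ qD]; exact: H.
Qed.

(** Divisors of [n] among the divisors of the product of [T], each weighted by
itself; its mean value over [n] is the number of subsets of [T]. *)
Definition divisor_sum (R : realType) (m : nat) (T : {set 'I_m}) (n : nat) : R :=
  \sum_(D in powerset T) (setprod D)%:R * (setprod D %| n)%N%:R.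

(** Expand the product over subsets; a subset survives only if all its elements,
hence their product, divide [n]. *)
Lemma prod_dvd_le_divisor_sum (R : realType) (m : nat) (T : {set 'I_m}) (n : nat) : primeset T ->
  \prod_(p in T) (1 + (p : nat)%:R * (p %| n)%N%:R) <= divisor_sum R T n.
Proof.
move=> hT; rewrite prod_subset_expand; apply: ler_sum => D; rewrite powersetE => DT.
have hD := primesetS DT hT.
have [h|] := boolP [forall p in D, p %| n]%N.
  rewrite setprod_dvd //; last by move=> p pD; exact: (forall_inP h).
  rewrite mulr1 /setprod natr_prod; apply: ler_prod => p pD.
  by rewrite (forall_inP h p pD) mulr1 ler0n lexx.
move=> /forall_inPn[p pD pn]; rewrite (bigD1 p) //= (negbTE pn) mulr0 mul0r.
by rewrite mulr_ge0.
Qed.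

Lemma ramS_le_divisor_sum (R : realType) (m : nat) (T : {set 'I_m}) (n : nat) : primeset T ->
  `|ramS R T n| <= divisor_sum R T n / phiS R T.
Proof.
move=> hT; apply: (@le_trans _ _ (\prod_(p in T) (1 + (p : nat)%:R * (p %| n)%N%:R) / phiS R T)).
  rewrite /ramS /phiS normr_prod -prodfV -big_split /=; apply: ler_prod => p pT.
  have p1 := prime_gt1 (primesetP hT pT).
  have h1 : 0 < (p.-1)%:R :> R by rewrite ltr0n; lia.
  rewrite normr_ge0 /= /ram; case: ifP => _.
    rewrite normrN1 mulr1 ler_pdivlMr // mul1r.
    by apply: (@le_trans _ _ p%:R); rewrite ?ler_nat ?leq_pred ?lerDr.
  by rewrite mulr0 addr0 mul1r normfV normr_nat.
by rewrite ler_wpM2r ?prod_dvd_le_divisor_sum // invr_ge0 ltW // phiS_gt0.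
Qed.

(** There are [N %/ d] multiples of [d] between 1 and [N], and one more at 0; the
factor 2 pays for rounding and needs [d <= N]. *)
Lemma progression_bound (R : realType) (d N : nat) (F : nat -> R) : (0 < d <= N)%N ->
  (forall n, 0 <= F n) ->
  N%:R^-1 * \sum_(n < N.+1) d%:R * (d %| n)%N%:R * F n <=
  2 * (((N %/ d).+1)%:R^-1 * \sum_(j < (N %/ d).+1) F (d * j)%N).
Proof.
move=> /andP[d0 dN] F0; set J := (N %/ d).+1.
have NJ : (N < d * J)%N by rewrite mulnC ltn_ceil.
have J2 : (d * J <= 2 * N)%N.
  have := leq_trunc_div N d; rewrite /J mulnS mulnC; lia.
have le1 : \sum_(n < N.+1) d%:R * (d %| n)%N%:R * F n <= d%:R * \sum_(j < J) F (d * j)%N.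
  apply: (@le_trans _ _ (\sum_(n < d * J) d%:R * (d %| n)%N%:R * F n)).
    rewrite -!(big_mkord predT (fun n => d%:R * (d %| n)%N%:R * F n)).
    rewrite [leRHS](big_cat_nat (leq0n N.+1) NJ) /= lerDl.
    by apply: sumr_ge0 => n _; rewrite !mulr_ge0.
  rewrite (sum_residues d J (fun n => d%:R * (d %| n)%N%:R * F n)).
  case: d d0 {dN J2 NJ} @J => // d _ J; rewrite big_ord_recl /= [X in _ + X]big1 ?addr0.
    by rewrite mulr_sumr; apply: ler_sum => j _; rewrite add0n dvdn_mulr // mulr1.
  move=> r _; rewrite big1 // => j _; rewrite dvdn_addl ?dvdn_mulr //.
  by rewrite gtnNdvd ?mulr0 ?mul0r // /bump /=; have := ltn_ord r; lia.
have S0 : 0 <= \sum_(j < J) F (d * j)%N by apply: sumr_ge0.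
apply: le_trans (ler_wpM2l _ le1) _; first by rewrite invr_ge0.
rewrite !mulrA ler_wpM2r // mulrC ler_pdivrMr ?ltr0n; last by lia.
rewrite mulrAC ler_pdivlMr ?ltr0n // -!natrM ler_nat; lia.
Qed.

Definition piece (R : realType) (m s : nat) (w : {set 'I_m} -> R) (n : nat) : R :=
  \sum_(T in prime_class m s) w T * ramS R T n.

(** The weight and the length are functions of the point [x]: this is the
linearisation of the supremum over scales. *)
Definition pieceop (R : realType) (m s : nat) (w : nat -> {set 'I_m} -> R) (N : nat -> nat)
    (f : nat -> R) (x : nat) : R :=
  (N x)%:R^-1 * \sum_(1 <= n < (N x).+1) piece s (w x) n * f (x + n)%N.

(** Triangle inequality over all pairs of a set [T] and a subset of [T], each pair
contributing one maximal function along a progression. The number of subsets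
turns the base 4 into 8. *)
Lemma piece_lp (R : realType) (p : R) : 1 < p -> exists2 C : R, 0 < C &
  forall (m s L : nat) (w : nat -> {set 'I_m} -> R) (N : nat -> nat) (f : nat -> R),
   (forall x T, `|w x T| <= 4 ^+ #|T|) -> (forall x, (0 < N x)%N) ->
   (forall z, 0 <= f z) -> (forall z, (L <= z)%N -> f z = 0) ->
   \sum_(x < L) `|pieceop s w N f x| `^ p <=
     C * (\sum_(T in prime_class m s) 8 ^+ #|T| / phiS R T) `^ p * \sum_(z < L) f z `^ p.
Proof.
move=> p1; have p0 : 0 < p by lra.
have [C C0 H] := hl_forward p1.
exists (2 `^ p * C) => [|m s L w N f hw N0 f0 fL]; first by rewrite mulr_gt0 ?powR_gt0.
pose J (d x : nat) := (N x %/ d).+1.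
pose A (d x : nat) : R := 2 * ((J d x)%:R^-1 * \sum_(j < J d x) f (x + d * j)%N).
have A0 d x : 0 <= A d x by rewrite /A mulr_ge0 // mulr_ge0 ?invr_ge0 ?sumr_ge0.
pose I := ({set 'I_m} * {set 'I_m})%type.
pose P (i : I) := (i.1 \in prime_class m s) && (i.2 \in powerset i.1).
pose c (i : I) : R := 4 ^+ #|i.1| / phiS R i.1.
have P1 i : P i -> primeset i.1 /\ primeset i.2.
  move=> /andP[/prime_classP[h1 _ _]]; rewrite powersetE => h2; split=> //; exact: primesetS h1.
have c0 i : P i -> 0 <= c i.
  by move=> /P1[h _]; rewrite divr_ge0 ?exprn_ge0 // ltW // phiS_gt0.
have bound x : `|pieceop s w N f x| <= \sum_(i | P i) c i * A (setprod i.2) x.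
  rewrite /pieceop normrM normfV normr_nat.
  apply: (@le_trans _ _ ((N x)%:R^-1 * \sum_(1 <= n < (N x).+1) \sum_(i | P i)
      c i * ((setprod i.2)%:R * (setprod i.2 %| n)%N%:R * f (x + n)%N))).
    rewrite ler_wpM2l ?invr_ge0 //; apply: le_trans (ler_norm_sum _ _ _) _.
    apply: ler_sum => n _; rewrite normrM (ger0_norm (f0 _)).
    under [leRHS]eq_bigr do rewrite mulrA.
    rewrite -mulr_suml ler_wpM2r // /piece; apply: le_trans (ler_norm_sum _ _ _) _.
    rewrite /P -(pair_big_dep (fun T => T \in prime_class m s) (fun T D => D \in powerset T)
      (fun T D => c (T, D) * ((setprod D)%:R * (setprod D %| n)%N%:R))) /=.
    apply: ler_sum => T TP; rewrite /c /= -mulr_sumr normrM mulrAC -mulrA.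
    have [hT _ _] := prime_classP TP.
    apply: ler_pM => //; exact: ramS_le_divisor_sum.
  rewrite exchange_big mulr_sumr /=; apply: ler_sum => i Pi.
  rewrite -mulr_sumr mulrCA ler_wpM2l ?c0 //.
  have [_ hD] := P1 i Pi; have d0 := setprod_gt0 hD; move: (setprod i.2) d0 => d d0.
  have [dN|Nd] := leqP d (N x).
    apply: le_trans _ (progression_bound _ (fun n => f0 (x + n)%N)); last by rewrite d0.
    rewrite ler_wpM2l ?invr_ge0 // -(big_mkord predT (fun n => d%:R * (d %| n)%N%:R * f (x + n)%N)).
    by rewrite [leRHS]big_ltn // lerDr !mulr_ge0.
  rewrite big_nat big1 ?mulr0 // => n /andP[n0 nN].
  by rewrite gtnNdvd ?mulr0 ?mul0r //; lia.
apply: (@le_trans _ _ (\sum_(x < L) (\sum_(i | P i) c i * A (setprod i.2) x) `^ p)).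
  apply: ler_sum => x _; rewrite ge0_ler_powR ?nnegrE ?(ltW p0) //.
  by apply: sumr_ge0 => i Pi; rewrite mulr_ge0 ?c0.
apply: le_trans (@weighted_minkowski R _ P c L (fun i x => A (setprod i.2) x) p
   (2 `^ p * (C * \sum_(z < L) f z `^ p)) p1 c0 (fun i x _ => A0 _ _) _) _.
  move=> i /P1[_ hD]; rewrite /A.
  under eq_bigr do rewrite powRM // ?mulr_ge0 ?invr_ge0 ?sumr_ge0 //.
  rewrite -mulr_sumr ler_wpM2l ?powR_ge0 //; apply: H => //; exact: setprod_gt0.
have -> : \sum_(i | P i) c i = \sum_(T in prime_class m s) 8 ^+ #|T| / phiS R T.
  rewrite /P -(pair_big_dep (fun T => T \in prime_class m s) (fun T D => D \in powerset T)
      (fun T D => c (T, D))) /=.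
  apply: eq_bigr => T _; rewrite /c /= sumr_const card_powerset -[LHS]mulr_natl natrX mulrA.
  by rewrite -exprMn; congr (_ ^+ _ / _); rewrite -natrM.
by rewrite le_eqVlt; apply/orP; left; apply/eqP; ring.
Qed.

(** * Pieces of the majorant: the kernel of the composition with the adjoint *)

Lemma sum_interval (R : nmodType) (a b L : nat) (F : nat -> R) :
  \sum_(z < L) (if (a <= z < b)%N then F z else 0) = \sum_(a <= z < minn b L) F z.
Proof.
rewrite -(big_mkord predT (fun z => if (a <= z < b)%N then F z else 0)).
have [h|h] := leqP (minn b L) a.
  rewrite (big_geq h) big_nat big1 // => z /andP[_ zL].
  by rewrite ifF //; apply/negP => /andP[]; lia.
have h2 : (minn b L <= L)%N by rewrite geq_minr.
rewrite (big_cat_nat (leq0n a) (leq_trans (ltnW h) h2)) /= big_nat big1 ?add0r; last first.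
  by move=> z /andP[_ za]; rewrite leqNgt za.
rewrite (big_cat_nat (ltnW h) h2) /= [X in _ + X]big_nat [X in _ + X]big1 ?addr0; last first.
  by move=> z hz; rewrite ifF //; apply/negP => /andP[]; lia.
by apply: eq_big_nat => z hz; rewrite ifT //; lia.
Qed.

(** The matrix of [pieceop], so that sums over [z] may run over a window common to
all rows. *)
Definition piece_kernel (R : realType) (m s : nat) (w : nat -> {set 'I_m} -> R) (N : nat -> nat)
    (x z : nat) : R :=
  if (x.+1 <= z < x.+1 + N x)%N then (N x)%:R^-1 * piece s (w x) (z - x) else 0.

Lemma pieceop_kernel (R : realType) (m s L : nat) (w : nat -> {set 'I_m} -> R) (N : nat -> nat)
    (f : nat -> R) (x : nat) : (forall z, (L <= z)%N -> f z = 0) ->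
  pieceop s w N f x = \sum_(z < L) piece_kernel s w N x z * f z.
Proof.
move=> fL; pose F z := (N x)%:R^-1 * piece s (w x) (z - x) * f z.
have -> : \sum_(z < L) piece_kernel s w N x z * f z =
   \sum_(z < L) (if (x.+1 <= z < x.+1 + N x)%N then F z else 0).
  by apply: eq_bigr => z _; rewrite /piece_kernel; case: ifP => _; rewrite ?mul0r.
rewrite sum_interval.
have -> : \sum_(x.+1 <= z < minn (x.+1 + N x) L) F z = \sum_(x.+1 <= z < x.+1 + N x) F z.
  have FL z : (L <= z)%N -> F z = 0 by move=> h; rewrite /F fL ?mulr0.
  have [h|h] := leqP (x.+1 + N x) L; first by [].
  have [h2|h2] := leqP L x.+1.
    rewrite big_geq; last by lia.
    by rewrite big_nat big1 // => z hz; rewrite FL //; lia.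
  rewrite [RHS](big_cat_nat (ltnW h2) (ltnW h)) /=.
  by rewrite [X in _ + X]big_nat [X in _ + X]big1 ?addr0 // => z hz; rewrite FL //; lia.
rewrite /pieceop -[(N x).+1]/(1 + N x)%N !sum_shift mulr_sumr.
apply: eq_bigr => i _; rewrite /F mulrA.
have -> : (x.+1 + i - x = 1 + i)%N by lia.
by have -> : (x.+1 + i = x + (1 + i))%N by lia.
Qed.

Definition natdist (x y : nat) : nat := ((x - y) + (y - x))%N.

(** Bound for the diagonal terms [T = T'] in the correlation of two rows at
distance [n]. *)
Definition corr_weight (R : realType) (m s : nat) (n : nat) : R :=
  \sum_(T in prime_class m s) 16 ^+ #|T| * (divisor_sum R T n / phiS R T ^+ 2).

(** Bound for the total of the incomplete periods over all pairs [T], [T']. *)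
Definition corr_error (R : realType) (m s : nat) : R :=
  (\sum_(T in prime_class m s) 4 ^+ #|T|) ^+ 2 * (2 ^+ s.+1) ^+ 2.

Lemma divisor_sum_ge0 (R : realType) (m n : nat) (T : {set 'I_m}) : 0 <= divisor_sum R T n.
Proof. by apply: sumr_ge0 => D _; rewrite mulr_ge0. Qed.

Lemma corr_weight_ge0 (R : realType) (m s n : nat) : 0 <= corr_weight R m s n.
Proof.
apply: sumr_ge0 => T _; rewrite mulr_ge0 ?exprn_ge0 //.
by rewrite divr_ge0 ?divisor_sum_ge0 // exprn_even_ge0.
Qed.

Lemma piece_corr (R : realType) (m s : nat) (w w' : {set 'I_m} -> R) (a b len : nat) :
  (forall T, `|w T| <= 4 ^+ #|T|) -> (forall T, `|w' T| <= 4 ^+ #|T|) ->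
  `|\sum_(i < len) piece s w (i + a) * piece s w' (i + b)| <=
    len%:R * corr_weight R m s (natdist a b) + corr_error R m s.
Proof.
move=> hw hw'.
have -> : \sum_(i < len) piece s w (i + a) * piece s w' (i + b) =
  \sum_(T in prime_class m s) \sum_(T' in prime_class m s) w T * w' T' *
     \sum_(i < len) ramS R T (i + a) * ramS R T' (i + b).
  under eq_bigr => i _ do rewrite /piece mulr_suml.
  rewrite exchange_big /=; apply: eq_bigr => T _.
  under eq_bigr => i _ do rewrite mulr_sumr.
  rewrite exchange_big /=; apply: eq_bigr => T' _.
  by rewrite mulr_sumr; apply: eq_bigr => i _; rewrite mulrACA.
have dvE (p : nat) : (a == b %[mod p]) = (p %| natdist a b)%N.
  rewrite /natdist; have [h|h] := leqP a b.
    by rewrite eq_sym eqn_mod_dvd //; congr (_ %| _)%N; lia.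
  by rewrite eqn_mod_dvd ?(ltnW h) //; congr (_ %| _)%N; lia.
apply: (@le_trans _ _ (\sum_(T in prime_class m s) \sum_(T' in prime_class m s)
   (4 ^+ #|T| * 4 ^+ #|T'| * (len%:R * ((T == T')%:R * (divisor_sum R T (natdist a b) / phiS R T ^+ 2)))
    + 4 ^+ #|T| * 4 ^+ #|T'| * (2 ^+ s.+1) ^+ 2))).
  apply: le_trans (ler_norm_sum _ _ _) _; apply: ler_sum => T /prime_classP[hT _ Ts].
  apply: le_trans (ler_norm_sum _ _ _) _; apply: ler_sum => T' /prime_classP[hT' _ Ts'].
  rewrite normrM -mulrDr normrM; apply: ler_pM => //; first exact: ler_pM.
  apply: le_trans (ramS_corr _ _ _ _ hT hT') _; apply: lerD.
    have -> : \prod_(p in T) ((1 + (p : nat)%:R * (a == b %[mod p])%:R) / (p.-1)%:R ^+ 2) =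
       (\prod_(p in T) (1 + (p : nat)%:R * (a == b %[mod p])%:R)) / phiS R T ^+ 2.
      by rewrite /phiS -prodrXl -prodfV -big_split.
    rewrite ler_wpM2l // ler_wpM2l // ler_wpM2r ?invr_ge0 ?sqr_ge0 //.
    apply: le_trans (prod_dvd_le_divisor_sum R _ hT).
    by apply: ler_prod => p pT; rewrite -dvE lexx addr_ge0 // mulr_ge0.
  rewrite expr2; apply: ler_pM => //; by rewrite -natrX ler_nat ltnW.
under eq_bigr do rewrite big_split /=.
rewrite big_split /=; apply: lerD.
  rewrite /corr_weight mulr_sumr; apply: ler_sum => T TP.
  rewrite (bigD1 T) //= eqxx mul1r big1 ?addr0; last first.
    by move=> T' /andP[_ /negbTE h]; rewrite eq_sym h mul0r !mulr0.
  rewrite -exprMn -natrM mulrCA; by rewrite lexx.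
rewrite /corr_error [X in _ <= X * _]expr2 !mulr_suml le_eqVlt; apply/orP; left; apply/eqP.
by apply: eq_bigr => T _; rewrite mulr_sumr mulr_suml.
Qed.

(** Entry of the composition with the adjoint. The two rows overlap in an interval
of length at most [N y], which cancels one of the two normalisations; what is
left is an average over the longer length [N x], whichever row it comes from. *)
Lemma piece_kernel_corr (R : realType) (m s L : nat) (w : nat -> {set 'I_m} -> R) (N : nat -> nat)
    (x y : nat) : (forall x T, `|w x T| <= 4 ^+ #|T|) -> (0 < N y)%N -> (N y <= N x)%N ->
  `|\sum_(z < L) piece_kernel s w N x z * piece_kernel s w N y z| <=
   (if (natdist x y <= N x)%N then
      (N x)%:R^-1 * (corr_weight R m s (natdist x y) + corr_error R m s / (N y)%:R) else 0).
Proof.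
move=> hw Ny Nyx; set X := minn (x.+1 + N x) (y.+1 + N y); set z0 := (maxn x y).+1.
pose F z := (N x)%:R^-1 * (N y)%:R^-1 * (piece s (w x) (z - x) * piece s (w y) (z - y)).
have -> : \sum_(z < L) piece_kernel s w N x z * piece_kernel s w N y z =
  \sum_(z < L) (if (z0 <= z < X)%N then F z else 0).
  apply: eq_bigr => z _; rewrite /piece_kernel /F /z0 /X.
  case: ifP => h1; last by rewrite mul0r ifF //; apply/negP => /andP[]; lia.
  case: ifP => h2; last by rewrite mulr0 ifF //; apply/negP => /andP[]; lia.
  by rewrite ifT; [rewrite mulrACA | lia].
rewrite sum_interval.
have [h|h] := leqP (minn X L) z0.
  rewrite big_geq // normr0; case: ifP => // _.
  by rewrite mulr_ge0 ?invr_ge0 // addr_ge0 ?corr_weight_ge0 ?divr_ge0 // mulr_ge0 ?sqr_ge0.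
have dN : (natdist x y <= N x)%N by rewrite /natdist; move: h; rewrite /X /z0; lia.
rewrite dN -(subnKC (ltnW h)) sum_shift -mulr_sumr normrM ger0_norm ?mulr_ge0 ?invr_ge0 //.
rewrite -mulrA ler_wpM2l ?invr_ge0 // ler_pdivrMl ?ltr0n // mulrDr.
set len := (minn X L - z0)%N.
have -> : \sum_(i < len) piece s (w x) (z0 + i - x) * piece s (w y) (z0 + i - y) =
  \sum_(i < len) piece s (w x) (i + (z0 - x)) * piece s (w y) (i + (z0 - y)).
  apply: eq_bigr => i _.
  have -> : (z0 + i - x = i + (z0 - x))%N by rewrite /z0; lia.
  by have -> : (z0 + i - y = i + (z0 - y))%N by rewrite /z0; lia.
apply: le_trans (piece_corr _ _ _ _ (hw x) (hw y)) _.
have -> : natdist (z0 - x) (z0 - y) = natdist x y by rewrite /natdist /z0; lia.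
apply: lerD; last by rewrite mulrCA divff ?mulr1 // pnatr_eq0 -lt0n.
rewrite ler_wpM2r ?corr_weight_ge0 // ler_nat /len /X /z0; lia.
Qed.

(** * Pieces of the majorant: square-summable functions *)

Lemma sum_pick (R : realType) (L k : nat) (F : nat -> R) :
  \sum_(y < L) (y == k :> nat)%:R * F y = if (k < L)%N then F k else 0.
Proof.
case: ifP => kL.
  rewrite (bigD1 (Ordinal kL)) //= eqxx mul1r big1 ?addr0 // => y yk.
  by case: eqP => [e|]; rewrite ?mul0r //; case/eqP: yk; apply/val_inj.
rewrite big1 // => y _; case: eqP => [e|]; rewrite ?mul0r //.
by have := ltn_ord y; rewrite e kL.
Qed.

(** The arithmetic-geometric mean inequality against the forward and the backward
maximal function along progressions of step [d]. *)
Lemma progression_form (R : realType) : exists2 C : R, 0 < C &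
  forall (L d : nat) (N : nat -> nat) (g : nat -> R), (0 < d)%N -> (forall x, d <= N x)%N ->
   (forall x, 0 <= g x) ->
   \sum_(x < L) g x * \sum_(y < L)
      (if (natdist x y <= N x)%N then (N x)%:R^-1 * (d%:R * (d %| natdist x y)%N%:R) * g y else 0)
   <= C * \sum_(x < L) g x ^+ 2.
Proof.
have two : 1 < 2 :> R by lra.
have [C1 C10 H1] := hl_forward two; have [C2 C20 H2] := hl_backward two.
exists (2 + C1 + C2) => [|L d N g d0 dN g0]; first by rewrite !addr_gt0.
pose J x := (N x %/ d).+1.
pose g0' z := if (z < L)%N then g z else 0.
have g0'0 z : 0 <= g0' z by rewrite /g0'; case: ifP.
pose g1 x n := if (n <= x)%N then g (x - n)%N else 0.
have g10 x n : 0 <= g1 x n by rewrite /g1; case: ifP.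
pose F1 x : R := (J x)%:R^-1 * \sum_(j < J x) g0' (x + d * j)%N.
pose F2 x : R := (J x)%:R^-1 * \sum_(j < J x | (d * j <= x)%N) g (x - d * j)%N.
have E2 x : F2 x = (J x)%:R^-1 * \sum_(j < J x) g1 x (d * j)%N.
  by rewrite /F2 big_mkcond.
have pw (a : R) : 0 <= a -> a `^ 2 = a ^+ 2 by move=> a0; rewrite -powR_mulrn.
have F10 x : 0 <= F1 x by rewrite mulr_ge0 ?invr_ge0 ?sumr_ge0.
have F20 x : 0 <= F2 x by rewrite mulr_ge0 ?invr_ge0 ?sumr_ge0.
have B1 : \sum_(x < L) F1 x ^+ 2 <= C1 * \sum_(x < L) g x ^+ 2.
  have := H1 L d g0' J d0 g0'0; move=> /(_ _ _) h.
  apply: le_trans (le_trans (h _ _) _).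
  - by apply: ler_sum => x _; rewrite -/(F1 x) pw.
  - by move=> z Lz; rewrite /g0' ltnNge Lz.
  - by [].
  by rewrite ler_pM2l //; apply: ler_sum => x _; rewrite /g0' ltn_ord pw.
have B2 : \sum_(x < L) F2 x ^+ 2 <= C2 * \sum_(x < L) g x ^+ 2.
  apply: le_trans (le_trans (H2 L d g J d0 g0 _) _) => //.
  - by apply: ler_sum => x _; rewrite -/(F2 x) pw.
  by rewrite ler_pM2l //; apply: ler_sum => x _; rewrite pw.
have key (x : 'I_L) : \sum_(y < L)
      (if (natdist x y <= N x)%N then (N x)%:R^-1 * (d%:R * (d %| natdist x y)%N%:R) * g y else 0)
   <= 2 * F1 x + 2 * F2 x.
  have dN' : (0 < d <= N x)%N by rewrite d0 dN.
  rewrite E2; apply: le_trans _ (lerD (progression_bound dN' (fun n => g0'0 (x + n)%N))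
                               (progression_bound dN' (g10 x))).
  rewrite -mulrDr -big_split /=.
  under [X in _ <= _ * X]eq_bigr => n _ do rewrite -mulrDr.
  pose c n : R := d%:R * (d %| n)%N%:R; have c0 n : 0 <= c n by rewrite mulr_ge0.
  apply: (@le_trans _ _ ((N x)%:R^-1 * \sum_(n < (N x).+1) c n * \sum_(y < L)
      ((y == (x + n)%N :> nat)%:R * g y + (x == (y + n)%N :> nat)%:R * g y))).
    under [X in _ <= _ * X]eq_bigr => n _ do rewrite mulr_sumr.
    rewrite exchange_big mulr_sumr /=; apply: ler_sum => y _.
    have nn (n : nat) : 0 <= c n * ((y == (x + n)%N :> nat)%:R * g y + (x == (y + n)%N :> nat)%:R * g y).
      by rewrite mulr_ge0 // addr_ge0 // mulr_ge0.
    case: ifP => h; last by rewrite mulr_ge0 ?invr_ge0 // sumr_ge0.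
    rewrite -mulrA ler_wpM2l ?invr_ge0 //.
    have h' : (natdist x y < (N x).+1)%N by rewrite ltnS.
    rewrite (bigD1 (Ordinal h')) //= -[leLHS]addr0; apply: lerD; last by apply: sumr_ge0.
    rewrite -/(c _) ler_wpM2l // -mulrDl -[leLHS]mul1r ler_wpM2r //.
    have [xy|xy] := leqP x y.
      have -> : (y == (x + natdist x y)%N :> nat) by apply/eqP; rewrite /natdist; lia.
      by rewrite lerDl.
    have -> : (x == (y + natdist x y)%N :> nat) by apply/eqP; rewrite /natdist; lia.
    by rewrite lerDr.
  rewrite ler_wpM2l ?invr_ge0 //; apply: ler_sum => n _.
  rewrite -/(c n) ler_wpM2l // big_split /= sum_pick lerD2l /g1.
  case: leqP => xn.
    rewrite (eq_bigr (fun y : 'I_L => (y == (x - n)%N :> nat)%:R * g y)); last first.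
      by move=> y _; congr ((nat_of_bool _)%:R * _); apply/eqP/eqP; lia.
    by rewrite sum_pick; case: ifP.
  rewrite big1 // => y _; case: eqP; rewrite ?mul0r //; lia.
apply: (@le_trans _ _ (\sum_(x < L) (2 * g x ^+ 2 + F1 x ^+ 2 + F2 x ^+ 2))).
  apply: ler_sum => x _; apply: le_trans (ler_wpM2l (g0 x) (key x)) _.
  have := sqr_ge0 (g x - F1 x); have := sqr_ge0 (g x - F2 x).
  rewrite !sqrrB; move: (g x) (F1 x) (F2 x) => u v z; rewrite !expr2; nra.
rewrite !big_split /= -mulr_sumr; move: B1 B2; lra.
Qed.

(** The norms of a matrix and of its transpose agree. Pairing [f] with the
transpose applied to [g := t f], weighted by [B], avoids square roots. *)
Lemma l2_duality (R : realType) (L : nat) (t : nat -> nat -> R) (f : nat -> R) (B : R) : 0 < B ->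
  (forall g : nat -> R, \sum_(z < L) (\sum_(x < L) t x z * g x) ^+ 2 <= B * \sum_(x < L) g x ^+ 2) ->
  \sum_(x < L) (\sum_(z < L) t x z * f z) ^+ 2 <= B * \sum_(z < L) f z ^+ 2.
Proof.
move=> B0 H; pose g x := \sum_(z < L) t x z * f z.
have := H g; rewrite -/g.
set G := \sum_(x < L) g x ^+ 2; set Fs := \sum_(z < L) f z ^+ 2.
pose h z := \sum_(x < L) t x z * g x.
have E : G = \sum_(z < L) f z * h z.
  rewrite /G /h; under [RHS]eq_bigr do rewrite mulr_sumr.
  rewrite exchange_big /=; apply: eq_bigr => x _.
  rewrite expr2 {1}/g mulr_suml; apply: eq_bigr => z _; ring.
rewrite -/(h _); set Hs := \sum_(z < L) _ => HB.
have : \sum_(z < L) 2 * B * (f z * h z) <= \sum_(z < L) (B ^+ 2 * f z ^+ 2 + h z ^+ 2).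
  apply: ler_sum => z _; have := sqr_ge0 (B * f z - h z); rewrite sqrrB exprMn; lra.
rewrite -mulr_sumr -E big_split /= -mulr_sumr -/Fs.
have -> : \sum_(i < L) h i ^+ 2 = Hs by [].
rewrite expr2 => h1.
have : B * G <= B * (B * Fs) by lra.
by rewrite ler_pM2l.
Qed.

(** Bound on the composition with the adjoint by the test of absolute values: each
entry is charged to its row of larger length, and every divisor in the diagonal
term gives a progression form. The number of subsets turns the base 16 into 32,
and [K] is a common lower bound of the lengths, which makes the error small. *)
Lemma piece_l2 (R : realType) : exists2 C : R, 0 < C &
  forall (m s L : nat) (w : nat -> {set 'I_m} -> R) (N : nat -> nat) (f : nat -> R) (K A : R),
   (forall x T, `|w x T| <= 4 ^+ #|T|) -> (forall x, 2 ^ s.+1 <= N x)%N ->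
   0 < K -> (forall x, K <= (N x)%:R) -> 0 < A ->
   \sum_(T in prime_class m s) 32 ^+ #|T| / phiS R T ^+ 2 + corr_error R m s / K <= A ->
   (forall z, (L <= z)%N -> f z = 0) ->
   \sum_(x < L) pieceop s w N f x ^+ 2 <= C * A * \sum_(z < L) f z ^+ 2.
Proof.
have [C C0 H] := progression_form R.
exists (2 * C) => [|m s L w N f K A hw hN K0 hK A0 hA fL]; first exact: mulr_gt0.
have N0 x : (0 < N x)%N by apply: leq_trans (hN x); rewrite expn_gt0.
under eq_bigr do rewrite (pieceop_kernel _ _ _ _ fL).
apply: l2_duality; first by rewrite !mulr_gt0.
move=> g; pose e := corr_error R m s / K.
have err0 : 0 <= corr_error R m s by rewrite /corr_error mulr_ge0 ?sqr_ge0.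
have e0 : 0 <= e by rewrite divr_ge0 // ltW.
pose b x y : R := if (natdist x y <= N x)%N then
      (N x)%:R^-1 * (corr_weight R m s (natdist x y) + e) else 0.
have b0 x y : 0 <= b x y.
  rewrite /b; case: ifP => // _; by rewrite mulr_ge0 ?invr_ge0 // addr_ge0 ?corr_weight_ge0.
have bb x y : (N y <= N x)%N -> `|\sum_(z < L) piece_kernel s w N x z * piece_kernel s w N y z| <= b x y.
  move=> Nyx; apply: le_trans (piece_kernel_corr _ _ _ (N0 y) Nyx) _ => //.
  rewrite /b; case: ifP => // _; rewrite ler_wpM2l ?invr_ge0 // lerD2l ler_wpM2l //.
  by rewrite lef_pV2 ?posrE ?ltr0n.
have BB x y : `|\sum_(z < L) piece_kernel s w N x z * piece_kernel s w N y z| <= b x y + b y x.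
  case: (leqP (N y) (N x)) => h; first by apply: le_trans (bb _ _ h) _; rewrite lerDl.
  under eq_bigr do rewrite mulrC.
  by apply: le_trans (bb _ _ (ltnW h)) _; rewrite lerDr.
have -> : \sum_(z < L) (\sum_(x < L) piece_kernel s w N x z * g x) ^+ 2 =
  \sum_(x < L) \sum_(y < L) g x * g y * \sum_(z < L) piece_kernel s w N x z * piece_kernel s w N y z.
  under eq_bigr => z _ do rewrite expr2 mulr_suml.
  rewrite exchange_big /=; apply: eq_bigr => x _.
  under eq_bigr => z _ do rewrite mulr_sumr.
  rewrite exchange_big /=; apply: eq_bigr => y _.
  by rewrite mulr_sumr; apply: eq_bigr => z _; ring.
apply: (@le_trans _ _ (\sum_(x < L) \sum_(y < L) `|g x| * `|g y| * (b x y + b y x))).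
  apply: ler_sum => x _; apply: ler_sum => y _.
  by apply: le_trans (ler_norm _) _; rewrite !normrM ler_wpM2l ?mulr_ge0.
have -> : \sum_(x < L) \sum_(y < L) `|g x| * `|g y| * (b x y + b y x) =
   2 * \sum_(x < L) `|g x| * \sum_(y < L) b x y * `|g y|.
  under eq_bigr do under eq_bigr do rewrite mulrDr.
  under eq_bigr do rewrite big_split /=.
  rewrite big_split /= [X in _ + X]exchange_big /= mulr_natl mulr2n.
  congr (_ + _); apply: eq_bigr => x _; rewrite mulr_sumr; apply: eq_bigr => y _; ring.
rewrite -!mulrA ler_pM2l //.
pose D d : R := \sum_(x < L) `|g x| * \sum_(y < L)
   (if (natdist x y <= N x)%N then (N x)%:R^-1 * (d%:R * (d %| natdist x y)%N%:R) * `|g y| else 0).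
have Dle d : (0 < d <= 2 ^ s.+1)%N -> D d <= C * \sum_(x < L) g x ^+ 2.
  move=> /andP[d0 ds].
  have -> : \sum_(x < L) g x ^+ 2 = \sum_(x < L) `|g x| ^+ 2.
    by apply: eq_bigr => x _; rewrite real_normK // num_real.
  by apply: (H L d N (fun x => `|g x|)) => // x; apply: leq_trans ds (hN x).
have -> : \sum_(x < L) `|g x| * \sum_(y < L) b x y * `|g y| =
   \sum_(T in prime_class m s) \sum_(U in powerset T) 16 ^+ #|T| / phiS R T ^+ 2 * D (setprod U)
   + e * D 1%N.
  rewrite /D; under [X in X + _]eq_bigr do under eq_bigr do rewrite mulr_sumr.
  under [X in X + _]eq_bigr do rewrite exchange_big /=.
  rewrite exchange_big mulr_sumr /= -big_split /=; apply: eq_bigr => x _.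
  rewrite mulrCA.
  under [X in X + _]eq_bigr do under eq_bigr do rewrite mulrCA.
  under [X in X + _]eq_bigr do rewrite -mulr_sumr.
  rewrite -mulr_sumr -mulrDr; congr (_ * _).
  under [X in X + _]eq_bigr do under eq_bigr do rewrite mulr_sumr.
  under [X in X + _]eq_bigr do rewrite exchange_big /=.
  rewrite exchange_big mulr_sumr /= -big_split /=; apply: eq_bigr => y _.
  rewrite /b; case: ifP => _; last first.
    by rewrite mul0r mulr0 addr0 big1 // => T _; rewrite big1 // => U _; rewrite mulr0.
  rewrite dvd1n !mulr1 mulrDr mulrDl; congr (_ + _); last by ring.
  rewrite /corr_weight mulr_sumr mulr_suml; apply: eq_bigr => T _.
  rewrite /divisor_sum mulr_suml !mulr_sumr mulr_suml; apply: eq_bigr => U _; ring.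
set S := \sum_(x < L) g x ^+ 2 in Dle *.
have S0 : 0 <= S by apply: sumr_ge0 => x _; rewrite sqr_ge0.
apply: (@le_trans _ _ (\sum_(T in prime_class m s) \sum_(U in powerset T)
    16 ^+ #|T| / phiS R T ^+ 2 * (C * S) + e * (C * S))).
  apply: lerD; last by rewrite ler_wpM2l // Dle // expn_gt0.
  apply: ler_sum => T /prime_classP[hT _ Ts]; apply: ler_sum => U; rewrite powersetE => UT.
  rewrite ler_wpM2l ?divr_ge0 ?exprn_ge0 //; first by rewrite ltW // phiS_gt0.
  apply: Dle; rewrite setprod_gt0 ?(primesetS UT) //=.
  by apply: leq_trans (ltnW Ts); rewrite dvdn_leq ?setprod_gt0 ?setprodS.
have -> : \sum_(T in prime_class m s) \sum_(U in powerset T) 16 ^+ #|T| / phiS R T ^+ 2 * (C * S)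
   = (\sum_(T in prime_class m s) 32 ^+ #|T| / phiS R T ^+ 2) * (C * S).
  rewrite mulr_suml; apply: eq_bigr => T _.
  rewrite sumr_const card_powerset -[LHS]mulr_natl natrX !mulrA -exprMn.
  by congr (_ ^+ _ / _ * _ * _); rewrite -natrM.
rewrite -mulrDl mulrCA ler_pM2l // ler_wpM2r //.
Qed.

(** * Interpolation and summation over the dyadic pieces *)

Lemma pow2_ge1 (R : realType) (s : nat) : 1 <= 2 ^+ s :> R.
Proof. by rewrite exprn_ege1 // ler1n. Qed.

Lemma piece_lp_pow (R : realType) (p e : R) : 1 < p -> 0 < e -> exists2 C : R, 0 < C &
  forall (m s L : nat) (w : nat -> {set 'I_m} -> R) (N : nat -> nat) (f : nat -> R),
   (forall x T, `|w x T| <= 4 ^+ #|T|) -> (forall x, (0 < N x)%N) ->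
   (forall z, 0 <= f z) -> (forall z, (L <= z)%N -> f z = 0) ->
   \sum_(x < L) `|pieceop s w N f x| `^ p <= C * (2 ^+ s) `^ e * \sum_(z < L) f z `^ p.
Proof.
move=> p1 e0; have p0 : 0 < p by lra.
have [C C0 H] := piece_lp p1.
have [D D0 HD] := @sum_prime_class_phi R 8 (e / p) ltac:(lra) (divr_gt0 e0 p0).
exists (C * D `^ p) => [|m s L w N f hw N0 f0 fL]; first by rewrite mulr_gt0 ?powR_gt0.
apply: le_trans (H m s L w N f hw N0 f0 fL) _.
rewrite ler_wpM2r; [by []|by apply: sumr_ge0 => z _; exact: powR_ge0|].
rewrite -mulrA ler_pM2l //.
have -> : D `^ p * (2 ^+ s) `^ e = (D * (2 ^+ s) `^ (e / p)) `^ p.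
  by rewrite powRM ?powR_ge0 ?(ltW D0) // -powRrM divfK // gt_eqF.
rewrite ge0_ler_powR ?nnegrE ?(ltW p0) ?HD //.
  apply: sumr_ge0 => T /prime_classP[hT _ _]; rewrite divr_ge0 ?exprn_ge0 //.
  by rewrite ltW // phiS_gt0.
by rewrite mulr_ge0 ?powR_ge0 // ltW.
Qed.

(** A row of length [N x] carries only sets [T] whose product is a small power of
[N x]; rows that are too short for the class [s] vanish on it. *)
Definition row_ok (R : realType) (m s : nat) (w : nat -> {set 'I_m} -> R) (N : nat -> nat) (x : nat) :=
  (2 ^ (8 * s).+1 <= N x)%N || [forall T in prime_class m s, w x T == 0].

(** The diagonal has mass about [X^(e-1)] for [X = 2^s], and the error is at most
about [X^(4 + 2e)], which the length [X^8] makes harmless. *)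
Lemma piece_l2_pow (R : realType) (e : R) : 0 < e -> e < 1 -> exists2 C : R, 0 < C &
  forall (m s L : nat) (w : nat -> {set 'I_m} -> R) (N : nat -> nat) (f : nat -> R),
   (forall x T, `|w x T| <= 4 ^+ #|T|) -> (forall x, row_ok s w N x) ->
   (forall z, (L <= z)%N -> f z = 0) ->
   \sum_(x < L) pieceop s w N f x ^+ 2 <= C * (2 ^+ s) `^ (e - 1) * \sum_(z < L) f z ^+ 2.
Proof.
move=> e0 e1.
have [C C0 H] := piece_l2 R.
have [D D0 HD] := @sum_prime_class_phi2 R 32 e ltac:(lra) e0.
have [E E0 HE] := @sum_prime_class R 4 e ltac:(lra) e0.
exists (C * (D + 4 * E ^+ 2)) => [|m s L w N f hw hrow fL].
  by rewrite mulr_gt0 // addr_gt0 // mulr_gt0 // exprn_gt0.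
pose X : R := 2 ^+ s; have X1 : 1 <= X := pow2_ge1 R s.
have X0 : 0 < X by lra.
(* Vanishing rows may be lengthened freely, so all rows become long. *)
pose N' x := if (2 ^ (8 * s).+1 <= N x)%N then N x else (2 ^ (8 * s).+1)%N.
have N'0 x : (2 ^ (8 * s).+1 <= N' x)%N by rewrite /N'; case: ifP.
have -> : \sum_(x < L) pieceop s w N f x ^+ 2 = \sum_(x < L) pieceop s w N' f x ^+ 2.
  apply: eq_bigr => x _; congr (_ ^+ 2); rewrite /N' /pieceop.
  have := hrow x; rewrite /row_ok; case: ifP => //= h /forall_inP hz.
  have z n : piece s (w x) n = 0.
    by rewrite /piece big1 // => T /hz/eqP->; rewrite mul0r.
  by rewrite !big1 ?mulr0 // => n _; rewrite z mul0r.
have A0 : 0 < (D + 4 * E ^+ 2) * X `^ (e - 1).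
  by rewrite mulr_gt0 ?powR_gt0 // addr_gt0 // mulr_gt0 // exprn_gt0.
rewrite -(mulrA C); apply: (H m s L w N' f (X ^+ 8)) => //.
- by move=> x; apply: leq_trans (N'0 x); rewrite leq_exp2l //; lia.
- exact: exprn_gt0.
- move=> x; rewrite /X -exprM -natrX ler_nat mulnC; apply: leq_trans (N'0 x).
  by rewrite leq_exp2l.
rewrite mulrDl; apply: lerD.
  apply: le_trans (HD m s) _; rewrite -mulrA ler_pM2l // powRD_gt0 //.
  by rewrite (powRN X 1) powRr1 // ltW.
rewrite ler_pdivrMr ?exprn_gt0 // /corr_error (_ : 2 ^+ s.+1 = 2 * X); last by rewrite exprS.
rewrite [(2 * X) ^+ 2]exprMn.
have S0 : 0 <= \sum_(T in prime_class m s) (4 : R) ^+ #|T| by apply: sumr_ge0 => T _; exact: exprn_ge0.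
apply: (@le_trans _ _ ((E * X * X `^ e) ^+ 2 * (2 ^+ 2 * X ^+ 2))).
  rewrite ler_wpM2r ?mulr_ge0 ?exprn_ge0 // ?(ltW X0) // lerXn2r ?nnegrE //.
  by rewrite !mulr_ge0 ?powR_ge0 // ltW.
have -> : (E * X * X `^ e) ^+ 2 * (2 ^+ 2 * X ^+ 2) =
   4 * E ^+ 2 * (X ^+ 4 * (X `^ e) ^+ 2) by ring.
rewrite -[leRHS]mulrA ler_pM2l ?mulr_gt0 ?exprn_gt0 //.
have -> : X ^+ 4 * (X `^ e) ^+ 2 = X `^ (4 + e * 2).
  by rewrite powRD_gt0 // powRrM !powR_mulrn ?powR_ge0 // ltW.
have -> : (2 ^+ s) `^ (e - 1) * X ^+ 8 = X `^ (e - 1 + 8).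
  by rewrite [in RHS]powRD_gt0 // powR_mulrn // ltW.
by rewrite ler_powR //; lra.
Qed.

(** Interpolation between the exponents [(p + 1) / 2], with a small power of
[X = 2^s] lost, and 2, with almost a full power gained, for [f] cut at height
[X^(1/2) * t]. At [p = 2] the second bound is already the claim. *)
Lemma piece_decay (R : realType) (p : R) : 1 < p -> p <= 2 -> exists2 C : R, 0 < C &
  forall (m s L : nat) (w : nat -> {set 'I_m} -> R) (N : nat -> nat) (f : nat -> R),
   (forall x T, `|w x T| <= 4 ^+ #|T|) -> (forall x, (0 < N x)%N) -> (forall x, row_ok s w N x) ->
   (forall z, 0 <= f z) -> (forall z, (L <= z)%N -> f z = 0) ->
   \sum_(x < L) `|pieceop s w N f x| `^ p <=
     C * (2 ^+ s) `^ (- ((p - 1) / 8)) * \sum_(z < L) f z `^ p.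
Proof.
move=> p1 p2; have e0 : 0 < (p - 1) / 16 by lra.
have e1 : (p - 1) / 16 < 1 by lra.
have [C2 C20 H2] := piece_l2_pow e0 e1.
have pw (a : R) : 0 <= a -> a `^ 2 = a ^+ 2 by move=> a0; rewrite -powR_mulrn.
move: p2; rewrite le_eqVlt => /predU1P[pE|p2].
  exists C2 => // m s L w N f hw N0 hrow f0 fL; rewrite pE.
  have := H2 m s L w N f hw hrow fL; rewrite pE => h.
  apply: le_trans (le_trans h _).
    by apply: ler_sum => x _; rewrite pw // real_normK ?num_real.
  have -> : \sum_(z < L) f z ^+ 2 = \sum_(z < L) f z `^ 2.
    by apply: eq_bigr => z _; rewrite pw.
  rewrite ler_wpM2r; [by []|by apply: sumr_ge0 => z _; exact: powR_ge0|].
  by rewrite ler_pM2l // ler_powR ?pow2_ge1 //; lra.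
pose p0 := (p + 1) / 2; have p01 : 1 < p0 by rewrite /p0; lra.
have [C1 C10 H1] := @piece_lp_pow R p0 ((p - 1) / 8) p01 ltac:(lra).
have p00 : 0 < p0 by lra.
have p0p : p0 < p by rewrite /p0; lra.
have [C3 C30 M] := marcinkiewicz p00 p0p p2.
exists (C3 * (C1 + C2)) => [|m s L w N f hw N0 hrow f0 fL].
  by rewrite mulr_gt0 // addr_gt0.
pose X : R := 2 ^+ s; have X1 : 1 <= X := pow2_ge1 R s.
have X0 : 0 < X by lra.
have := M L (fun x => `|pieceop s w N f x|) f (C1 * X `^ ((p - 1) / 8))
  (C2 * X `^ ((p - 1) / 16 - 1)) (X `^ 2^-1).
move=> h; apply: le_trans (h _ _ _ _ _ _) _ => // {h}.
- by rewrite mulr_ge0 ?powR_ge0 // ltW.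
- by rewrite mulr_ge0 ?powR_ge0 // ltW.
- by rewrite powR_gt0.
- move=> t t0; set ga := X `^ 2^-1.
  pose g z := if ga * t < f z then f z else 0.
  pose h z := if f z <= ga * t then f z else 0.
  have fE z : f z = g z + h z by rewrite /g /h; case: ltP; rewrite ?addr0 ?add0r.
  have g0 z : 0 <= g z by rewrite /g; case: ifP.
  have h0 z : 0 <= h z by rewrite /h; case: ifP.
  have gL z : (L <= z)%N -> g z = 0 by move=> Lz; rewrite /g fL //; case: ifP.
  have hL z : (L <= z)%N -> h z = 0 by move=> Lz; rewrite /h fL //; case: ifP.
  have TE x : pieceop s w N f x = pieceop s w N g x + pieceop s w N h x.
    rewrite /pieceop -mulrDr -big_split /=; congr (_ * _); apply: eq_bigr => n _.
    by rewrite fE mulrDr.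
  apply: (@le_trans _ _ (\sum_(x < L) (t `^ (- p0) * `|pieceop s w N g x| `^ p0 +
                                     t `^ (- 2) * `|pieceop s w N h x| `^ 2))).
    rewrite big_mkcond; apply: ler_sum => x _.
    have nn : 0 <= t `^ (- p0) * `|pieceop s w N g x| `^ p0 +
                   t `^ (- 2) * `|pieceop s w N h x| `^ 2.
      by rewrite addr_ge0 // mulr_ge0 // powR_ge0.
    case: ifP => // hx.
    (* One of the two parts exceeds t wherever the sum exceeds 2t. *)
    have cheb (a q : R) : 0 < q -> t < a -> 1 <= t `^ (- q) * a `^ q.
      move=> q0 ta; rewrite powRN ler_pdivlMl ?powR_gt0 // mulr1.
      by rewrite ge0_ler_powR ?nnegrE ?(ltW q0) ?(ltW t0) ?(ltW ta) // ltW // (lt_trans t0).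
    have [hg|hg] := ltP t `|pieceop s w N g x|.
      apply: le_trans (cheb _ _ p00 hg) _; rewrite lerDl mulr_ge0 ?powR_ge0 //.
    have hh : t < `|pieceop s w N h x|.
      by move: hx; rewrite TE; have := ler_normD (pieceop s w N g x) (pieceop s w N h x); lra.
    apply: le_trans (cheb _ 2 _ hh) _ => //; rewrite lerDr mulr_ge0 ?powR_ge0 //.
  rewrite big_split /= -!mulr_sumr; apply: lerD.
    rewrite [X in _ <= X * _]mulrC -[leRHS]mulrA ler_wpM2l ?powR_ge0 //.
    apply: le_trans (H1 m s L w N g hw N0 g0 gL) _.
    rewrite ler_wpM2l ?mulr_ge0 ?powR_ge0 ?(ltW C10) // [leRHS]big_mkcond /=.
    apply: ler_sum => z _; rewrite /g; case: ifP => // _; rewrite powR0 ?gt_eqF //.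
  rewrite [X in _ <= X * _]mulrC -[leRHS]mulrA ler_wpM2l ?powR_ge0 //.
  have := H2 m s L w N h hw hrow hL => hb.
  apply: le_trans (le_trans hb _).
    by apply: ler_sum => x _; rewrite pw // real_normK ?num_real.
  rewrite ler_wpM2l ?mulr_ge0 ?powR_ge0 ?(ltW C20) // [leRHS]big_mkcond /=.
  by apply: ler_sum => z _; rewrite /h; case: ifP => // _; rewrite ?pw // expr0n.
rewrite ler_wpM2r; [by []|by apply: sumr_ge0 => z _; exact: powR_ge0|].
rewrite -(mulrA C3) ler_pM2l // [(C1 + C2) * _]mulrDl.
by apply: lerD; rewrite -mulrA ler_pM2l // -powRrM -powRD_gt0 // ler_powR // /p0; lra.
Qed.

(** Hoelder's inequality with weights that decay like the norms of the pieces. *)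
Lemma sum_pieces (R : realType) (p : R) : 1 < p -> p <= 2 -> exists2 C : R, 0 < C &
  forall (m S L : nat) (w : nat -> {set 'I_m} -> R) (N : nat -> nat) (f : nat -> R),
   (forall x T, `|w x T| <= 4 ^+ #|T|) -> (forall x, (0 < N x)%N) ->
   (forall s x, row_ok s w N x) ->
   (forall z, 0 <= f z) -> (forall z, (L <= z)%N -> f z = 0) ->
   \sum_(x < L) (\sum_(s < S) `|pieceop s w N f x|) `^ p <= C * \sum_(z < L) f z `^ p.
Proof.
move=> p1 p2; have p0 : 0 < p by lra.
have [C C0 H] := piece_decay p1 p2.
pose de := (p - 1) / 8 / p; have de0 : 0 < de by rewrite !divr_gt0 //; lra.
have [G G0 HG] := geom_down de0.
exists (G `^ p * C) => [|m S L w N f hw N0 hrow f0 fL]; first by rewrite mulr_gt0 ?powR_gt0.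
(* The exponent de is the decay of the p-th root of the bound for one piece. *)
pose c (s : 'I_S) : R := (2 ^+ s) `^ (- de).
have c0 s : 0 < c s by rewrite powR_gt0 // exprn_gt0.
have E x : \sum_(s < S) `|pieceop s w N f x| = \sum_(s < S) c s * (`|pieceop s w N f x| / c s).
  by apply: eq_bigr => s _; rewrite mulrCA divff ?mulr1 // gt_eqF.
under eq_bigr do rewrite E.
apply: le_trans (@weighted_minkowski R _ predT c L
  (fun s x => `|pieceop s w N f x| / c s) p (C * \sum_(z < L) f z `^ p) p1 _ _ _) _.
- by move=> s _; exact: ltW.
- by move=> s x _; rewrite divr_ge0 // ltW.
- move=> s _.
  under eq_bigr do rewrite powRM ?invr_ge0 ?(ltW (c0 _)) //.
  rewrite -mulr_suml; apply: le_trans (ler_wpM2r (powR_ge0 _ _) (H m s L w N f hw N0 (hrow s) f0 fL)) _.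
  rewrite mulrAC ler_wpM2r; [by []|by apply: sumr_ge0 => z _; exact: powR_ge0|].
  rewrite -[(c s)^-1]powR_inv1 ?(ltW (c0 _)) // /c -!powRrM -mulrA -powRD_gt0 ?exprn_gt0 //.
  rewrite -[leRHS]mulr1 ler_pM2l // /de.
  have -> : - ((p - 1) / 8) + - ((p - 1) / 8 / p) * (-1 * p) = 0 by field; rewrite gt_eqF.
  by rewrite powRr0.
rewrite -mulrA ler_wpM2r //.
  by rewrite mulr_ge0 ?(ltW C0) // sumr_ge0 // => z _; exact: powR_ge0.
rewrite ge0_ler_powR ?nnegrE ?(ltW p0) ?(ltW G0) //.
  by apply: sumr_ge0 => s _; exact: ltW.
have := HG S 1 1 ltr01 ltr01; rewrite powR1 mulr1 => h; apply: le_trans _ h.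
rewrite le_eqVlt; apply/orP; left; apply/eqP; apply: eq_big => s; first by rewrite mul1r pow2_ge1.
by rewrite mul1r.
Qed.

(** * Dyadic averages over primes on a window *)

Lemma ln_le_exp2 (R : realType) (q k : nat) : (q <= 2 ^ k)%N -> ln (q%:R : R) <= 2 * k%:R.
Proof.
have [->|q0] := posnP q; first by rewrite ln0 // mulr_ge0.
move=> h; apply: (@le_trans _ _ (ln (2 ^+ k))).
  by rewrite ler_ln ?posrE ?ltr0n ?exprn_gt0 // -natrX ler_nat.
rewrite lnXn // -[ln _ *+ k]mulr_natr ler_wpM2r // ltW // ln_sublinear //.
Qed.

Lemma piece_decomp (R : realType) (m j S : nat) (w : {set 'I_m} -> R) (n : nat) :
  (forall T, w T != 0 -> primeset T && (setprod T <= 2 ^ (2 * j))%N) -> (2 * j < S)%N ->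
  \sum_(T : {set 'I_m}) w T * ramS R T n = \sum_(s < S) piece s w n.
Proof.
move=> hw jS; rewrite /piece.
under [RHS]eq_bigr do rewrite big_mkcond.
rewrite exchange_big /=; apply: eq_bigr => T _.
have [->|/hw/andP[hT hS]] := eqVneq (w T) 0.
  by rewrite mul0r big1 // => s _; rewrite if_same.
have T0 := setprod_gt0 hT.
have /andP[b1 b2] := trunc_log_bounds (isT : 1 < 2)%N T0.
have tS : (trunc_log 2 (setprod T) < S)%N.
  apply: leq_ltn_trans jS; rewrite -(leq_exp2l (m := 2)) //; exact: leq_trans b1 hS.
rewrite (bigD1 (Ordinal tS)) //= inE hT b1 b2 /= big1 ?addr0 // => s hs.
case: ifP => //; rewrite inE hT /= => h; case/eqP: hs; apply/val_inj.
by rewrite /= (trunc_log_eq _ h).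
Qed.

(** The primes up to [2 ^ j], for [j] the integral part of [k / 32], are so few that
the trivial bound by an interval of that length is enough. On the other primes
[ln] is at most a constant times the sieve weight. *)
Lemma prime_window (R : realType) (p : R) : 1 < p -> p <= 2 -> exists2 C : R, 0 < C &
  forall (L Kmax : nat) (k : nat -> nat) (f : nat -> R),
   (forall x, 0 < k x <= Kmax)%N ->
   (forall z, 0 <= f z) -> (forall z, (L <= z)%N -> f z = 0) ->
   \sum_(x < L) ((2 ^ k x)%:R^-1 *
       \sum_(0 <= q < (2 ^ k x).+1 | prime q) ln q%:R * f (x + q)%N) `^ p
     <= C * \sum_(z < L) f z `^ p.
Proof.
move=> p1 p2; have p0 : 0 < p by lra.
have [C1 C10 H1] := hl_strong p1.
have [C2 C20 H2] := sum_pieces p1 p2.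
exists (2 `^ p * (C1 + 256 `^ p * C2)) => [|L Kmax k f hk f0 fL].
  by rewrite !mulr_gt0 ?powR_gt0 ?addr_gt0 ?mulr_gt0 ?powR_gt0.
pose m := (2 ^ Kmax).+1; pose S := (2 * Kmax).+1.
pose j x := (k x %/ 32)%N.
have jk x : (32 * j x <= k x)%N by rewrite mulnC leq_trunc_div.
have kj x : (k x <= 32 * (j x).+1)%N by rewrite mulnC ltnW // ltn_ceil.
have jm x : (2 ^ j x < m)%N.
  by rewrite ltnS leq_exp2l //; have := hk x; have := jk x; lia.
have [w hw] := choice (fun x => selberg_weight R (jm x)).
pose N x := (2 ^ k x)%N.
have N0 x : (0 < N x)%N by rewrite expn_gt0.
have w4 x T : `|w x T| <= 4 ^+ #|T| by have [h _ _ _] := hw x.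
have wS x n : \sum_(T : {set 'I_m}) w x T * ramS R T n = \sum_(s < S) piece s (w x) n.
  have [_ h _ _] := hw x; apply: (@piece_decomp _ _ (j x)) => //.
  by have := hk x; have := jk x; rewrite /S; lia.
have rows s x : row_ok s w N x.
  rewrite /row_ok; case: (boolP [forall T in prime_class m s, w x T == 0]) => [|/forall_inPn[T Ts wT]].
    by rewrite orbT.
  have [_ /(_ T wT)/andP[hT hj] _ _] := hw x.
  have [_ sT _] := prime_classP Ts.
  have sj : (s <= 2 * j x)%N by rewrite -(leq_exp2l (m := 2)) //; exact: leq_trans sT hj.
  by rewrite orbF /N leq_exp2l //; have := hk x; have := jk x; lia.
pose J x := (2 ^ j x).+1.
pose F1 x : R := (J x)%:R^-1 * \sum_(i < J x) f (x + i)%N.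
pose F2 x : R := \sum_(s < S) `|pieceop s w N f x|.
have F10 x : 0 <= F1 x by rewrite mulr_ge0 ?invr_ge0 ?sumr_ge0.
have F20 x : 0 <= F2 x by rewrite sumr_ge0.
have key x : (2 ^ k x)%:R^-1 * \sum_(0 <= q < (2 ^ k x).+1 | prime q) ln q%:R * f (x + q)%N
   <= F1 x + 256 * F2 x.
  pose nu n : R := \sum_(s < S) piece s (w x) n.
  have nu0 n : 0 <= nu n by rewrite /nu -wS; have [_ _ h _] := hw x.
  have nup q : prime q -> (2 ^ j x < q)%N -> (j x).+1%:R <= 4 * nu q.
    by rewrite /nu -wS; have [_ _ _ h] := hw x; exact: h.
  have step : \sum_(0 <= q < (2 ^ k x).+1 | prime q) ln q%:R * f (x + q)%N <=
    2 * (j x)%:R * (\sum_(i < J x) f (x + i)%N) +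
    256 * \sum_(1 <= n < (2 ^ k x).+1) nu n * f (x + n)%N.
    apply: (@le_trans _ _ (\sum_(0 <= q < (2 ^ k x).+1)
       ((if (q < J x)%N then 2 * (j x)%:R * f (x + q)%N else 0) +
        (if (0 < q)%N then 256 * (nu q * f (x + q)%N) else 0)))).
      rewrite big_mkcond /= big_nat [leRHS]big_nat; apply: ler_sum => q /andP[_ qk].
      have n1 : 0 <= (if (q < J x)%N then 2 * (j x)%:R * f (x + q)%N else 0).
        by case: ifP => // _; rewrite !mulr_ge0.
      have n2 : 0 <= (if (0 < q)%N then 256 * (nu q * f (x + q)%N) else 0).
        by case: ifP => // _; rewrite !mulr_ge0.
      case: ifP => pq; last by rewrite addr_ge0.
      move: n1 n2; rewrite prime_gt0 //; case: ltnP => hq n1 n2.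
        rewrite -[leLHS]addr0; apply: lerD => //.
        by rewrite ler_wpM2r // ln_le_exp2.
      rewrite add0r mulrA ler_wpM2r //.
      apply: le_trans (ln_le_exp2 R (_ : q <= 2 ^ k x)%N) _ => //.
      have := nup q pq hq; have : (k x)%:R <= 32 * (j x).+1%:R :> R.
        by rewrite -natrM ler_nat.
      by lra.
    rewrite big_split /=; apply: lerD.
      rewrite mulr_sumr -(big_mkord predT (fun i => 2 * (j x)%:R * f (x + i)%N)).
      rewrite -big_mkcond /= big_mkord.
      have JN : (J x <= (2 ^ k x).+1)%N.
        by rewrite ltnS leq_exp2l //; have := jk x; lia.
      rewrite -(big_mkord (fun i => (i < J x)%N) (fun i => 2 * (j x)%:R * f (x + i)%N)).
      by rewrite [leRHS](big_nat_widen _ _ _ _ _ JN) /=.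
    rewrite big_ltn_cond // ltnn add0r mulr_sumr le_eqVlt; apply/orP; left; apply/eqP.
    by apply: eq_big_nat => n /andP[n0 _]; rewrite n0.
  apply: le_trans (ler_wpM2l _ step) _; first by rewrite invr_ge0.
  rewrite mulrDr; apply: lerD.
    rewrite /F1 !mulrA ler_wpM2r ?sumr_ge0 //.
    have J0 : 0 < (J x)%:R :> R by rewrite ltr0n.
    rewrite -[leRHS]mul1r ler_pdivlMr // -!mulrA ler_pdivrMl ?ltr0n ?expn_gt0 //.
    rewrite mulr1 -!natrM ler_nat /J.
    have [->|j0] := posnP (j x); first by rewrite mul0n muln0.
    apply: (@leq_trans (2 ^ (j x + j x).+2)%N); last by rewrite leq_exp2l //; have := jk x; lia.
    have := ltn_expl (j x) (isT : 1 < 2)%N.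
    have : (0 < 2 ^ j x)%N by rewrite expn_gt0.
    rewrite !expnS expnD; move: (2 ^ j x)%N => u; nia.
  rewrite mulrCA ler_pM2l // /F2.
  have -> : (2 ^ k x)%:R^-1 * \sum_(1 <= n < (2 ^ k x).+1) nu n * f (x + n)%N =
     \sum_(s < S) pieceop s w N f x.
    rewrite /pieceop -mulr_sumr exchange_big /=; congr (_ * _); apply: eq_bigr => n _.
    by rewrite /nu mulr_suml.
  by apply: ler_sum => s _; exact: ler_norm.
apply: (@le_trans _ _ (\sum_(x < L) 2 `^ p * (F1 x `^ p + 256 `^ p * F2 x `^ p))).
  apply: ler_sum => x _.
  have F3 : 0 <= 256 * F2 x by rewrite mulr_ge0.
  rewrite -(powRM p _ (F20 x)) //.
  apply: (@le_trans _ _ ((F1 x + 256 * F2 x) `^ p)).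
    rewrite ge0_ler_powR ?nnegrE ?(ltW p0) ?addr_ge0 //.
    rewrite mulr_ge0 ?invr_ge0 // sumr_ge0 // => q pq.
    by rewrite mulr_ge0 // ln_ge0 // ler1n prime_gt0.
  have M0 : 0 <= Num.max (F1 x) (256 * F2 x) by rewrite le_max F10.
  have M1 : 0 <= 2 * Num.max (F1 x) (256 * F2 x) by rewrite mulr_ge0.
  have F4 : 0 <= F1 x + 256 * F2 x by rewrite addr_ge0.
  apply: (@le_trans _ _ ((2 * Num.max (F1 x) (256 * F2 x)) `^ p)).
    rewrite ge0_ler_powR ?nnegrE ?(ltW p0) //.
    have h1 : F1 x <= Num.max (F1 x) (256 * F2 x) by rewrite le_max lexx.
    have h2 : 256 * F2 x <= Num.max (F1 x) (256 * F2 x) by rewrite le_max lexx orbT.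
    by move: h1 h2; move: (Num.max _ _) => M h1 h2; lra.
  rewrite [(2 * Num.max _ _) `^ p]powRM // ler_wpM2l ?powR_ge0 //.
  by case: (leP (F1 x) (256 * F2 x)) => _; rewrite ?lerDl ?lerDr powR_ge0.
rewrite -mulr_sumr -mulrA ler_wpM2l ?powR_ge0 // big_split /= mulrDl; apply: lerD.
  by apply: H1.
rewrite -mulr_sumr -mulrA ler_wpM2l ?powR_ge0 //; exact: H2.
Qed.

(** * A lower bound of Chebyshev type *)

Lemma exp2_le_bin (n : nat) : (2 ^ n <= 'C(n.*2, n))%N.
Proof.
elim: n => // n IH; rewrite doubleS binS expnS mul2n -addnn; apply: leq_add.
  by apply: leq_trans IH _; rewrite binS leq_addl.
rewrite -(bin_sub (n := n.*2.+1) (m := n)); last by rewrite -addnn; lia.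
have -> : (n.*2.+1 - n = n.+1)%N by rewrite -addnn; lia.
by apply: leq_trans IH _; rewrite binS leq_addl.
Qed.

(** Legendre's formula: each power of [p] up to [2n] contributes at most 1. *)
Lemma logn_central_bin (p n : nat) : prime p -> (0 < n)%N ->
  (logn p 'C(n.*2, n) <= trunc_log p n.*2)%N.
Proof.
move=> pp n0; have p1 := prime_gt1 pp.
have nn : (n <= n.*2)%N by rewrite -addnn leq_addr.
have bp : (0 < 'C(n.*2, n))%N by rewrite bin_gt0.
have := bin_fact nn; have -> : (n.*2 - n = n)%N by rewrite -addnn addnK.
move=> /(congr1 (logn p)); rewrite !lognM ?muln_gt0 ?fact_gt0 // !logn_fact //.
have -> : (\sum_(1 <= k < n.+1) n %/ p ^ k = \sum_(1 <= k < n.*2.+1) n %/ p ^ k)%N.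
  rewrite [RHS](@big_cat_nat _ _ _ n.+1) //= [X in (_ = _ + X)%N]big_nat.
  rewrite [X in (_ = _ + X)%N]big1 ?addn0 // => k /andP[nk _].
  by rewrite divn_small // (ltn_trans nk) // ltn_expl.
move=> e; have : (\sum_(1 <= k < n.*2.+1) n.*2 %/ p ^ k <=
   \sum_(1 <= k < n.*2.+1) (n %/ p ^ k + n %/ p ^ k) + \sum_(1 <= k < n.*2.+1) (p ^ k <= n.*2))%N.
  rewrite -big_split /=; apply: leq_sum => k _.
  have pk : (0 < p ^ k)%N by rewrite expn_gt0 prime_gt0.
  have [h|h] := leqP (p ^ k) n.*2; last first.
    by rewrite divn_small.
  rewrite -ltnS ltn_divLR // -addnn.
  have := ltn_ceil n pk; move: (p ^ k)%N (n %/ p ^ k)%N => u v; nia.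
rewrite big_split /= -e [X in (X <= _)%N]addnC leq_add2l => h; apply: (leq_trans h) => {h e}.
have t0 := trunc_log_ltn n.*2 p1.
apply: (@leq_trans (\sum_(1 <= k < n.*2.+1) (k <= trunc_log p n.*2))%N).
  apply: leq_sum => k _; case: (leqP (p ^ k) n.*2) => // h.
  by rewrite trunc_log_max.
apply: (@leq_trans (\sum_(1 <= k < (trunc_log p n.*2).+1) 1)%N).
  rewrite -big_mkcond /=; have [h|h] := leqP (trunc_log p n.*2) n.*2.
    by rewrite [leqRHS](big_nat_widen _ _ n.*2.+1) //= leq_sum.
  by rewrite sum1_count; apply: leq_trans (count_size _ _) _; rewrite size_iota sum_nat_const_nat muln1; lia.
by rewrite sum_nat_const_nat muln1 subn1.
Qed.

Lemma sum_ln_logn (R : realType) (b : nat) : (0 < b)%N ->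
  ln (b%:R : R) = \sum_(0 <= p < b.+1 | prime p) (logn p b)%:R * ln p%:R.
Proof.
move=> b0; rewrite -{1}(partnT b0) /partn.
rewrite (big_mkcond (fun p => p \in _)) /=.
rewrite natr_prod.
have -> : \sum_(0 <= p < b.+1 | prime p) (logn p b)%:R * ln p%:R =
   \sum_(0 <= p < b.+1) (logn p b)%:R * ln (p%:R : R).
  rewrite [LHS]big_mkcond; apply: eq_bigr => p _; case: ifP => // h.
  by rewrite lognE h mul0r.
pose K (a c : R) := 0 < a /\ ln a = c.
suff : K (\prod_(0 <= p < b.+1) (p ^ logn p b)%:R) (\sum_(0 <= p < b.+1) (logn p b)%:R * ln p%:R).
  by case.
apply: (big_ind2 K); rewrite /K ?ln1 //.
  by move=> x1 x2 y1 y2 [h1 <-] [h2 <-]; rewrite mulr_gt0 // lnM ?posrE.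
move=> p _; have [->|p0] := posnP p.
  by rewrite lognE /= mul0r expn0 ln1.
by rewrite ltr0n expn_gt0 p0 natrX lnXn ?ltr0n // mulr_natl.
Qed.

(** Take logarithms in the factorisation of the central binomial coefficient. A
prime above the square root of [2^k] divides it at most once, and the others
contribute at most [k * ln 2] each, which is negligible for [k >= 12]; for
smaller [k] the prime 2 alone is enough. *)
Lemma chebyshev_pow2 (R : realType) : exists2 c : R, 0 < c &
  forall k : nat, (0 < k)%N -> c * 2 ^+ k <= @theta R (2 ^ k).
Proof.
have l2 : 0 < ln (2 : R) by rewrite ln_gt0 // ltr1n.
have lnp (q : nat) : 0 <= ln (q%:R : R).
  by have [->|q0] := posnP q; [rewrite ln0 | rewrite ln_ge0 // ler1n].
exists (ln 2 / 2 ^+ 12) => [|k k0]; first by rewrite divr_gt0 ?exprn_gt0.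
have [k12|k12] := leqP 12 k; last first.
  apply: (@le_trans _ _ (ln 2)).
    rewrite mulrAC ler_pdivrMr ?exprn_gt0 // ler_pM2l // ler_weXn2l ?ler1n //; exact: ltnW.
  rewrite /theta big_mkcond (bigD1_seq 2%N) ?mem_index_iota ?iota_uniq //=; last first.
    by rewrite ltnS -{1}[2%N]expn1 leq_exp2l.
  by rewrite lerDl; apply: sumr_ge0 => q _; case: ifP.
pose n := (2 ^ k.-1)%N; have n0 : (0 < n)%N by rewrite expn_gt0.
have n2 : n.*2 = (2 ^ k)%N by rewrite /n -mul2n -expnS prednK.
have k2 : (0 < 2 ^ k)%N by rewrite expn_gt0.
pose b := 'C(n.*2, n); have b0 : (0 < b)%N by rewrite bin_gt0 -addnn leq_addr.
pose h := uphalf k.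
have kh : (k <= h.*2)%N by rewrite /h; lia.
have lo : n%:R * ln 2 <= ln (b%:R : R).
  have -> : n%:R * ln 2 = ln ((2 ^ n)%:R : R) by rewrite natrX lnXn // mulr_natl.
  by rewrite ler_ln ?posrE ?ltr0n ?expn_gt0 // ler_nat exp2_le_bin.
have hi : ln (b%:R : R) <= @theta R (2 ^ k) + (2 ^ h).+1%:R * (k%:R * ln 2).
  rewrite sum_ln_logn // /theta.
  apply: (@le_trans _ _ (\sum_(0 <= p < (2 ^ k).+1 | prime p)
     (ln p%:R + (if (p < (2 ^ h).+1)%N then k%:R * ln 2 else 0)))).
    apply: (@le_trans _ _ (\sum_(0 <= p < (2 ^ k).+1 | prime p) (logn p b)%:R * ln p%:R)).
      have ext M : (b < M)%N -> (2 ^ k < M)%N ->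
         \sum_(0 <= p < b.+1 | prime p) (logn p b)%:R * ln p%:R
         <= \sum_(0 <= p < (2 ^ k).+1 | prime p) (logn p b)%:R * ln (p%:R : R).
        move=> bM kM; apply: (@le_trans _ _ (\sum_(0 <= p < M | prime p) (logn p b)%:R * ln p%:R)).
          rewrite [leRHS](@big_cat_nat _ _ _ b.+1) //= lerDl.
          by apply: sumr_ge0 => q _; rewrite mulr_ge0.
        rewrite (@big_cat_nat _ _ _ (2 ^ k).+1) //= gerDl big_nat_cond big1 // => q.
        move=> /andP[/andP[kq _] pq].
        have := logn_central_bin pq n0; rewrite -/b n2 => hq.
        have -> : logn q b = 0%N; last by rewrite mul0r.
        apply/eqP; rewrite -leqn0; apply: leq_trans hq _.
        by rewrite leqn0 trunc_log_eq0; apply/orP; right; move: kq; lia.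
      by apply: (ext (b + 2 ^ k).+1); rewrite ltnS ?leq_addr ?leq_addl.
    rewrite big_nat_cond [leRHS]big_nat_cond; apply: ler_sum => q /andP[/andP[_ qk] pq].
    have q1 := prime_gt1 pq.
    have := logn_central_bin pq n0; rewrite -/b n2 => hq.
    case: ifP => hqh.
      apply: (@le_trans _ _ (k%:R * ln 2)); last by rewrite lerDr.
      have -> : k%:R * ln 2 = ln ((2 ^ k)%:R : R) by rewrite natrX lnXn // mulr_natl.
      have -> : (logn q b)%:R * ln q%:R = ln ((q ^ logn q b)%:R : R).
        by rewrite natrX lnXn ?ltr0n ?(ltnW q1) // mulr_natl.
      rewrite ler_ln ?posrE ?ltr0n ?expn_gt0 ?(ltnW q1) // ler_nat.
      apply: leq_trans (trunc_logP q1 k2) => //.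
      by rewrite leq_exp2l.
    rewrite addr0 -[leRHS]mul1r ler_wpM2r // -[1]/(1%:R) ler_nat.
    apply: leq_trans hq _; rewrite -ltnS -(ltn_exp2l _ _ q1).
    apply: leq_ltn_trans (trunc_logP q1 k2) _ => //.
    have : (2 ^ h < q)%N by rewrite ltnNge -ltnS hqh.
    move=> hq2; apply: (@leq_ltn_trans (2 ^ h * 2 ^ h)%N).
      by rewrite -expnD leq_exp2l // addnn.
    by rewrite expnS expn1 ltn_mul.
  rewrite big_split /= lerD2l.
  apply: (@le_trans _ _ (\sum_(0 <= p < (2 ^ k).+1) (if (p < (2 ^ h).+1)%N then k%:R * ln 2 else 0))).
    rewrite big_mkcond; apply: ler_sum => q _; case: ifP => // _.
    by case: ifP => // _; rewrite mulr_ge0 // ltW.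
  rewrite -big_mkcond /=.
  apply: (@le_trans _ _ (\sum_(0 <= p < (2 ^ h).+1) k%:R * ln 2)).
    have hk : ((2 ^ h).+1 <= (2 ^ k).+1)%N by rewrite ltnS leq_exp2l // /h; lia.
    by rewrite [leRHS](big_nat_widen _ _ _ _ _ hk).
  by rewrite sumr_const_nat subn0 -[leLHS]mulr_natl.
have num : (4 * ((2 ^ h).+1 * k) <= 2 ^ k)%N.
  (* Induction in steps of two, because the exponent h grows by one every two steps. *)
  have gen i : (4 * ((2 ^ (6 + i)).+1 * (12 + i.*2)) <= 2 ^ (12 + i.*2))%N /\
               (4 * ((2 ^ (7 + i)).+1 * (13 + i.*2)) <= 2 ^ (13 + i.*2))%N.
    elim: i => [|i [IH1 IH2]]; first by split; vm_compute.
    rewrite doubleS !addnS !(expnS _ (_ + _).+1) !(expnS _ (_ + _)).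
    have : (0 < 2 ^ (6 + i))%N by rewrite expn_gt0.
    have : (0 < 2 ^ (7 + i))%N by rewrite expn_gt0.
    move: IH1 IH2; move: (2 ^ (6 + i))%N (2 ^ (7 + i))%N (2 ^ (12 + i.*2))%N (2 ^ (13 + i.*2))%N (i.*2).
    by move=> u u' v v' z; split; nia.
  have [g1 g2] := gen ((k - 12)./2); have [ko|ke] := boolP (odd k).
    have e : (13 + ((k - 12)./2).*2 = k)%N by lia.
    have e2 : (7 + (k - 12)./2 = h)%N by rewrite /h; lia.
    by rewrite e e2 in g2.
  have e : (12 + ((k - 12)./2).*2 = k)%N by lia.
  have e2 : (6 + (k - 12)./2 = h)%N by rewrite /h; lia.
  by rewrite e e2 in g1.
have num' : 4 * ((2 ^ h).+1%:R * k%:R) <= 2 ^+ k :> R by rewrite -natrM -natrX -(natrM _ 4) ler_nat.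
have n2R : 2 * n%:R = 2 ^+ k :> R by rewrite -natrM mul2n n2 natrX.
have lo2 := le_trans lo hi.
apply: (@le_trans _ _ (ln 2 * (2 ^+ k / 4))).
  rewrite -mulrA ler_pM2l // mulrC ler_pM2l ?exprn_gt0 // lef_pV2 ?posrE ?exprn_gt0 //.
  by rewrite (_ : 4 = 2 ^+ 2) ?ler_weXn2l ?ler1n // -natrX.
have := ler_wpM2l (ltW l2) num'; move: lo2; rewrite -n2R.
move: (@theta R _) ((2 ^ h).+1%:R) => T u; nra.
Qed.

(** * From windows to the integers *)

Local Open Scope classical_set_scope.

Lemma normc_ge0 (R : realType) (z : R[i]) : 0 <= Normc.normc z.
Proof. by case: z => a b; exact: sqrtr_ge0. Qed.

Lemma normc_real (R : realType) (a : R) : 0 <= a -> Normc.normc (a%:C)%C = a.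
Proof. by move=> a0; rewrite /= expr0n addr0 sqrtr_sqr ger0_norm. Qed.

Lemma normcD (R : realType) (x y : R[i]) :
  Normc.normc (x + y) <= Normc.normc x + Normc.normc y.
Proof. exact: (@le_normcD R x y). Qed.

Lemma normc_sum (R : realType) (I : Type) (r : seq I) (P : pred I) (F : I -> R[i]) :
  Normc.normc (\sum_(i <- r | P i) F i) <= \sum_(i <- r | P i) Normc.normc (F i).
Proof.
apply: (big_ind2 (fun (z : R[i]) (t : R) => Normc.normc z <= t)) => //.
  by rewrite Normc.normc0.
by move=> x1 x2 y1 y2 h1 h2; apply: le_trans (normcD x1 y1) _; exact: lerD.
Qed.

(** Comparison average, normalised by its length instead of [theta]; it is applied
to absolute values. *)
Definition dyadic_avg (R : realType) (g : int -> R) (k : nat) (x : int) : R :=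
  (2 ^ k)%:R^-1 * \sum_(0 <= q < (2 ^ k).+1 | prime q) ln q%:R * g (x + q%:Z).

Lemma ln_nat_ge0 (R : realType) (q : nat) : 0 <= ln (q%:R : R).
Proof. by have [->|q0] := posnP q; [rewrite ln0 | rewrite ln_ge0 // ler1n]. Qed.

Lemma dyadic_avg_ge0 (R : realType) (g : int -> R) (k : nat) (x : int) :
  (forall x, 0 <= g x) -> 0 <= dyadic_avg g k x.
Proof.
move=> g0; rewrite mulr_ge0 ?invr_ge0 // sumr_ge0 // => q _.
by rewrite mulr_ge0 // ln_nat_ge0.
Qed.

Lemma prime_average_dyadic (R : realType) : exists2 C : R, 0 < C &
  forall (f : int -> R[i]) (N : nat) (x : int), (0 < N)%N ->
    exists2 k : nat, (0 < k)%N & Normc.normc (prime_average N f x) <=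
      C * dyadic_avg (fun y => Normc.normc (f y)) k x.
Proof.
have [c c0 Hc] := chebyshev_pow2 R.
exists (2 / c) => [|f N x N0]; first by rewrite divr_gt0.
pose g y := Normc.normc (f y); have g0 y : 0 <= g y := normc_ge0 _.
have [N1|N1] := leqP N 1.
  exists 1%N => //; have -> : prime_average N f x = 0.
    rewrite /prime_average big_nat_cond big1 ?mulr0 // => q /andP[/andP[_ qN]] /prime_gt1.
    by move: qN; lia.
  by rewrite Normc.normc0 mulr_ge0 ?divr_ge0 ?(ltW c0) ?dyadic_avg_ge0.
pose i := trunc_log 2 N.
have /andP[b1 b2] := trunc_log_bounds (isT : 1 < 2)%N N0; rewrite -/i in b1 b2.
have i0 : (0 < i)%N.
  by rewrite lt0n; apply: contraTneq b2 => ->; rewrite expn1 -leqNgt.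
exists i.+1 => //.
have th : c * 2 ^+ i <= @theta R N.
  apply: le_trans (Hc i i0) _; rewrite /theta.
  have h : ((2 ^ i).+1 <= N.+1)%N by [].
  rewrite [leRHS](big_cat_nat (leq0n _) h) /= lerDl sumr_ge0 // => q _; exact: ln_nat_ge0.
have th0 : 0 < @theta R N by apply: lt_le_trans th; rewrite mulr_gt0 ?exprn_gt0.
rewrite /prime_average Normc.normcM normc_real ?invr_ge0 ?(ltW th0) //.
apply: (@le_trans _ _ ((@theta R N)^-1 * \sum_(0 <= q < N.+1 | prime q) ln q%:R * g (x + q%:Z))).
  rewrite ler_pM2l ?invr_gt0 //; apply: le_trans (normc_sum _ _ _) _.
  by apply: ler_sum => q _; rewrite Normc.normcM normc_real ?ln_nat_ge0 // mulrC.
apply: (@le_trans _ _ ((@theta R N)^-1 * \sum_(0 <= q < (2 ^ i.+1).+1 | prime q) ln q%:R * g (x + q%:Z))).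
  rewrite ler_pM2l ?invr_gt0 //.
  have h : (N.+1 <= (2 ^ i.+1).+1)%N by apply: leqW.
  rewrite [leRHS](big_cat_nat (leq0n _) h) /= lerDl sumr_ge0 // => q _.
  by rewrite mulr_ge0 // ln_nat_ge0.
rewrite /dyadic_avg mulrA ler_wpM2r //.
  by rewrite sumr_ge0 // => q _; rewrite mulr_ge0 // ln_nat_ge0.
have -> : 2 / c / (2 ^ i.+1)%:R = (c * 2 ^+ i)^-1 :> R.
  rewrite natrX exprS; have : (2 : R) ^+ i != 0 by rewrite gt_eqF ?exprn_gt0.
  by move: (_ ^+ i) => u u0; field; rewrite u0 gt_eqF.
by rewrite lef_pV2 ?posrE // mulr_gt0 ?exprn_gt0.
Qed.

Lemma counting1 (R : realType) (z : int) : @counting int R [set z] = 1%E.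
Proof.
rewrite /counting asboolT; last exact: finite_set1.
by rewrite fset_set1 finmap.cardfs1.
Qed.

Lemma integral_indic_sum (R : realType) (n : nat) (e : nat -> int) (a : nat -> R) :
  (forall i, 0 <= a i) ->
  (\int[@counting int R]_x (\sum_(i < n) (a i * \1_[set e i] x)%:E) = (\sum_(i < n) a i)%:E)%E.
Proof.
move=> a0; rewrite ge0_integral_sum //; last first.
  by move=> i x _; rewrite lee_fin mulr_ge0.
rewrite -sumEFin; apply: eq_bigr => i _.
under eq_integral do rewrite EFinM.
rewrite ge0_integralZl_EFin //.
by rewrite integral_indic // setIT [X in (_ * X)%E](counting1 R (e i)) mule1.
Qed.

Lemma sum_window_indic (R : realType) (n M : nat) (a : int -> R) (x : int) :
  \sum_(i < n) a (i%:Z - M%:Z) * \1_[set i%:Z - M%:Z] x =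
  if (- M%:Z <= x) && (x < n%:Z - M%:Z) then a x else 0.
Proof.
case: ifP => hx.
  have xn : (absz (x + M%:Z)%R < n)%N by lia.
  have xE : (absz (x + M%:Z))%:Z - M%:Z = x by lia.
  rewrite (bigD1 (Ordinal xn)) //= xE indicE mem_set //= mulr1 big1 ?addr0 // => i ix.
  rewrite indicE memNset ?mulr0 //= => e; case/eqP: ix; apply/val_inj => /=; lia.
rewrite big1 // => i _; rewrite indicE memNset ?mulr0 //= => e.
by have := ltn_ord i; lia.
Qed.

Lemma sum_prefix_le (R : realType) (n L : nat) (A B : nat -> R) : (n <= L)%N ->
  (forall i, (i < n)%N -> A i <= B i) -> (forall i, 0 <= B i) ->
  \sum_(i < n) A i <= \sum_(i < L) B i.
Proof.
move=> nL AB B0; apply: (@le_trans _ _ (\sum_(i < n) B i)).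
  by apply: ler_sum => i _; exact: AB.
rewrite -!(big_mkord predT B) [leRHS](big_cat_nat (leq0n _) nL) /= lerDl.
exact: sumr_ge0.
Qed.

(** The scale may be chosen at each point of the window. The sum on the right runs
over a longer window because the averages look to the right. *)
Lemma window_bound (R : realType) (p : R) : 1 < p -> p <= 2 -> exists2 C : R, 0 < C &
  forall (g : int -> R) (M K : nat) (kap : int -> nat), (forall x, 0 <= g x) ->
    (forall x, 0 < kap x <= K)%N ->
    exists L : nat,
    \sum_(i < (2 * M).+1) dyadic_avg g (kap (i%:Z - M%:Z)) (i%:Z - M%:Z) `^ p <=
      C * \sum_(z < L) g (z%:Z - M%:Z) `^ p.
Proof.
move=> p1 p2; have p0 : 0 < p by lra.
have [C C0 H] := prime_window p1 p2.
exists C => // g M K kap g0 hk.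
pose n := (2 * M).+1; pose L := (n + 2 ^ K)%N; exists L.
pose f z := if (z < L)%N then g (z%:Z - M%:Z) else 0.
have f0 z : 0 <= f z by rewrite /f; case: ifP.
have fL z : (L <= z)%N -> f z = 0 by move=> Lz; rewrite /f ltnNge Lz.
have := H L K (fun z => kap (z%:Z - M%:Z)) f (fun z => hk _) f0 fL.
have -> : \sum_(z < L) f z `^ p = \sum_(z < L) g (z%:Z - M%:Z) `^ p.
  by apply: eq_bigr => z _; rewrite /f ltn_ord.
apply: le_trans.
have nL : (n <= L)%N by rewrite leq_addr.
apply: (@sum_prefix_le R n L
  (fun i => dyadic_avg g (kap (i%:Z - M%:Z)) (i%:Z - M%:Z) `^ p)
  (fun x => ((2 ^ kap (x%:Z - M%:Z))%:R^-1 * \sum_(0 <= q < (2 ^ kap (x%:Z - M%:Z)).+1 | prime q)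
                ln q%:R * f (x + q)%N) `^ p) nL) => [i hi|i]; last exact: powR_ge0.
rewrite le_eqVlt; apply/orP; left; apply/eqP.
congr (_ `^ _); rewrite /dyadic_avg; congr (_ * _).
rewrite big_nat_cond [RHS]big_nat_cond; apply: eq_bigr => q /andP[/andP[_ hq] _].
congr (_ * _); rewrite /f ifT.
  by congr g; rewrite PoszD; ring.
have : (2 ^ kap (i%:Z - M%:Z)%R <= 2 ^ K)%N by rewrite leq_exp2l //; have /andP[] := hk (i%:Z - M%:Z).
by move: hi hq; rewrite /L; lia.
Qed.

Theorem theorem7p1 (R : realType) (p : R) (hp : 1 < p <= 2) :
  exists2 C : R, 0 < C &
    forall f : int -> R[i], in_ellp p f ->
      (ellp_norm p (prime_maximal f) <=
         (C * (p - 1) ^- 4)%:E * ellp_normC p f)%E.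
Proof.
have [p1 p2] := andP hp; have p0 : 0 < p by lra.
have pn0 : p != 0 by rewrite gt_eqF.
have [C1 C10 H1] := prime_average_dyadic R.
have [C2 C20 H2] := window_bound p1 p2.
pose D := (C1 `^ p * C2) `^ p^-1.
have D0 : 0 < D by rewrite powR_gt0 // mulr_gt0 // powR_gt0.
have p40 : 0 < (p - 1) ^+ 4 by rewrite exprn_gt0; lra.
exists (D * (p - 1) ^+ 4); first by rewrite mulr_gt0.
move=> f _; rewrite mulfK ?gt_eqF //.
pose g x := Normc.normc (f x); have g0 x : 0 <= g x := normc_ge0 _.
pose F := prime_maximal f.
pose mu : {measure set int -> \bar R} := @counting int R.
pose I := (\int[mu]_x ((g x) `^ p)%:E)%E.
suff key : (\int[mu]_x (`|F x| `^ p) <= (C1 `^ p * C2)%:E * I)%E.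
  rewrite /ellp_normC /ellp_norm unlock.
  rewrite [X in (_ <= _ * X)%E](_ : _ = (I `^ p^-1)%E); last first.
    by congr (_ `^ _)%E; apply: eq_integral => x _; rewrite abse_EFin ger0_norm ?normc_ge0 // poweR_EFin.
  have I0 : (0 <= I)%E by apply: integral_ge0 => x _; rewrite lee_fin powR_ge0.
  rewrite /D -poweR_EFin -poweRM //; last by rewrite lee_fin mulr_ge0 ?powR_ge0 // ltW.
  apply: gt0_ler_poweR => //; first by rewrite invr_ge0 ltW.
    by rewrite in_itv /= leey andbT; apply: integral_ge0 => x _; exact: poweR_ge0.
  by rewrite in_itv /= leey andbT mule_ge0 // lee_fin mulr_ge0 ?powR_ge0 // ltW.
(* The best scale among the first M + 1; the pointwise suprema over these scales
increase with M to the full supremum. *)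
pose kap M (x : int) : nat := [arg max_(k > (ord0 : 'I_M.+1)) dyadic_avg g k.+1 x]%O.
have kapP M x k : (k <= M)%N -> dyadic_avg g k.+1 x <= dyadic_avg g (kap M x).+1 x.
  move=> kM; rewrite /kap; case: arg_maxP => //= i _ h.
  by have := h (Ordinal (kM : (k < M.+1)%N)) isT.
have kapM M x : (kap M x <= M)%N by rewrite /kap -ltnS ltn_ord.
pose b M x : R := dyadic_avg g (kap M x).+1 x `^ p.
have b0 M x : 0 <= b M x by exact: powR_ge0.
have bmono M M' x : (M <= M')%N -> b M x <= b M' x.
  move=> MM; rewrite /b ge0_ler_powR ?nnegrE ?(ltW p0) ?dyadic_avg_ge0 //.
  by apply: kapP; exact: leq_trans (kapM _ _) MM.
pose h M (x : int) : \bar R := (if (`|x| <= M)%N then b M x else 0)%:E.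
have h0 M x : (0 <= h M x)%E by rewrite lee_fin; case: ifP.
have hmono x : {homo h^~ x : n m / (n <= m)%N >-> (n <= m)%E}.
  move=> M M' MM; rewrite /h lee_fin; case: ifP => xM; last by case: ifP.
  by rewrite (leq_trans xM MM) bmono.
have hlim x M : (h M x <= limn (h^~ x))%E.
  rewrite (cvg_lim _ (ereal_nondecreasing_cvgn (hmono x))) //.
  by apply: ereal_sup_ubound; exists M.
have Hpt x : (`|F x| `^ p <= (C1 `^ p)%:E * limn (h^~ x))%E.
  set S := (X in (_ <= X)%E).
  have S0 : (0 <= S)%E.
    by rewrite mule_ge0 ?lee_fin ?powR_ge0 // (le_trans (h0 0%N x)).
  have FS : (F x <= S `^ p^-1)%E.
    apply: ge_ereal_sup => _ [N /= N0 <-].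
    have [k k0 hk] := H1 f N x N0.
    have -> : (Normc.normc (prime_average N f x))%:E =
       ((Normc.normc (prime_average N f x))%:E `^ p `^ p^-1)%E.
      by rewrite -poweRrM divff // poweRe1 // lee_fin normc_ge0.
    apply: gt0_ler_poweR; rewrite ?invr_ge0 ?(ltW p0) ?in_itv /= ?leey ?andbT ?poweR_ge0 //.
      by rewrite lee_fin powR_ge0.
    apply: (@le_trans _ _ ((C1 `^ p)%:E * h (`|x| + k)%N x)%E); last first.
      by rewrite /S lee_wpmul2l ?hlim // lee_fin powR_ge0.
    rewrite /h leq_addr -EFinM lee_fin.
    have A0 : 0 <= dyadic_avg g (kap (`|x| + k)%N x).+1 x := dyadic_avg_ge0 _ _ g0.
    rewrite /b -powRM ?(ltW C10) //.
    rewrite ge0_ler_powR ?nnegrE ?(ltW p0) ?normc_ge0 ?(mulr_ge0 (ltW C10) A0) //.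
    apply: le_trans hk _; rewrite ler_pM2l // -(prednK k0); apply: kapP.
    by have := leq_addl `|x|%N k; lia.
  have F0 : (0 <= F x)%E.
    apply: le_trans (ereal_sup_ubound _); last by exists 1%N.
    by rewrite lee_fin normc_ge0.
  rewrite gee0_abs //.
  have -> : S = ((S `^ p^-1) `^ p)%E by rewrite -poweRrM mulVf // poweRe1.
  apply: gt0_ler_poweR; rewrite ?(ltW p0) ?in_itv /= ?leey ?andbT ?poweR_ge0 //.
apply: (@le_trans _ _ (\int[mu]_x ((C1 `^ p)%:E * limn (h^~ x)))%E).
  apply: ge0_le_integral => //.
    by move=> x _; exact: poweR_ge0.
have lim0 x : (0 <= limn (h^~ x))%E by apply: le_trans (hlim x 0%N).
rewrite ge0_integralZl_EFin ?powR_ge0 //.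
rewrite EFinM -muleA lee_wpmul2l ?lee_fin ?powR_ge0 //.
rewrite monotone_convergence //.
apply: lime_le.
  apply: ereal_nondecreasing_is_cvgn => M M' MM; apply: ge0_le_integral => // x _.
  exact: hmono.
near=> M.
have kap1 x : (0 < (kap M x).+1 <= M.+1)%N by apply/andP; split=> //; rewrite ltnS; exact: kapM.
have [L HL] := H2 g M M.+1 (fun x => (kap M x).+1) g0 kap1.
have -> : (\int[mu]_x h M x = (\sum_(i < (2 * M).+1) b M (i%:Z - M%:Z))%:E)%E.
  rewrite -(@integral_indic_sum R _ (fun i => i%:Z - M%:Z) (fun i => b M (i%:Z - M%:Z))) //.
  apply: eq_integral => x _; rewrite sumEFin sum_window_indic /h; congr EFin.
  by congr (if _ then _ else _); apply/idP/idP; move: (x : int) => y; lia.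
apply: (@le_trans _ _ (C2 * \sum_(z < L) g (z%:Z - M%:Z) `^ p)%:E).
  by rewrite lee_fin.
rewrite EFinM lee_wpmul2l ?lee_fin ?(ltW C20) //.
rewrite -(@integral_indic_sum R _ (fun i => i%:Z - M%:Z) (fun i => g (i%:Z - M%:Z) `^ p)); last first.
  by move=> i; exact: powR_ge0.
apply: ge0_le_integral => //.
- by move=> x _; apply: sume_ge0 => i _; rewrite lee_fin mulr_ge0 ?powR_ge0.
- move=> x _; rewrite sumEFin lee_fin (sum_window_indic _ _ (fun x => g x `^ p)).
  by case: ifP => // _; exact: powR_ge0.
Unshelve. all: end_near. Qed.
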